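(* Let $F$ be a field of characteristic $2$ and let $n>1$ be an integer. Let $\pi$ and $\pi'$ be anisotropic $n$-fold Pfister forms over $F$ such that $\pi$ and $\pi'$ are not isometric. Then there exists a field extension $E/F$ such that $\pi_E$ and $\pi'_E$ are anisotropic, totally separably linked and totally inseparably linked, but not isometric.
   Context: For $a\in F$, $[1,a]$ denotes the quadratic form $(x,y)\mapsto x^2+xy+ay^2$ on $F^2$. An $n$-fold Pfister form over $F$ ($n\geq 1$) is a quadratic form isometric to $\langle\langle b_1,\ldots,b_{n-1},a]] := \langle 1,b_1\rangle_b\otimes\cdots\otimes\langle 1,b_{n-1}\rangle_b\otimes[1,a]$ with $a\in F$, $b_i\in F^\times$, i.e. the orthogonal sum of the forms $\left(\prod_{i\in I}b_i\right)[1,a]$ over all subsets $I\subseteq\{1,\ldots,n-1\}$. A quadratic form $(V,q)$ is isotropic if $q(x)=0$ for some $x\ne 0$, anisotropic otherwise; it is hyperbolic if it is isometric to an orthogonal sum of copies of the hyperbolic plane $\mathbb{H}=[0,0]$, $(x,y)\mapsto xy$. $\pi_K$ denotes the scalar extension of $\pi$ to a field extension $K/F$. For $n$-fold Pfister forms $\pi,\pi'$ over a field $F$: $\pi$ is totally separably (resp. inseparably) linked to $\pi'$ if for every separable (resp. inseparable) quadratic field extension $K/F$ such that $\pi_K$ is hyperbolic, $\pi'_K$ is also hyperbolic; $\pi$ and $\pi'$ are totally separably (resp. inseparably) linked if each is totally separably (resp. inseparably) linked to the other. *)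

(* Defs.v *)
From HB Require Import structures.
From mathcomp Require Import all_boot all_order all_algebra all_field.
From mathcomp Require Import ring.

Set Implicit Arguments.
Unset Strict Implicit.
Unset Printing Implicit Defensive.

Import GRing.Theory.
Local Open Scope ring_scope.

Definition polar (F : fieldType) (V : vectType F) (q : V -> F) (u v : V) : F :=
  q (u + v) - q u - q v.

(* [polar q] is symmetric, so linearity on one side is bilinearity. *)
Definition is_quadratic (F : fieldType) (V : vectType F) (q : V -> F) : Prop :=
  (forall (c : F) (v : V), q (c *: v) = c ^+ 2 * q v) /\
  (forall (c : F) (u v w : V),
     polar q (c *: u + v) w = c * polar q u w + polar q v w).

Record quadform (F : fieldType) (V : vectType F) : Type := QuadForm {
  qval :> V -> F;
  qvalP : is_quadratic qval
}.

Lemma is_quadratic_mul (F : fieldType) (V : vectType F) (l m : V -> F) :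
  scalar l -> scalar m -> is_quadratic (fun v => l v * m v).
Proof.
move=> ll lm.
have l0 : l 0 = 0.
  by have := ll 1 0 0; rewrite scale1r addr0 mul1r => /eqP;
    rewrite eq_sym -subr_eq0 addrK => /eqP.
have m0 : m 0 = 0.
  by have := lm 1 0 0; rewrite scale1r addr0 mul1r => /eqP;
    rewrite eq_sym -subr_eq0 addrK => /eqP.
have lZ c v : l (c *: v) = c * l v by have := ll c v 0; rewrite l0 !addr0.
have mZ c v : m (c *: v) = c * m v by have := lm c v 0; rewrite m0 !addr0.
have lD u v : l (u + v) = l u + l v by have := ll 1 u v; rewrite scale1r mul1r.
have mD u v : m (u + v) = m u + m v by have := lm 1 u v; rewrite scale1r mul1r.
split=> [c v|c u v w]; rewrite /polar ?lD ?mD ?lZ ?mZ; ring.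
Qed.

Lemma is_quadratic_scale (F : fieldType) (V : vectType F) (c : F) (q : V -> F) :
  is_quadratic q -> is_quadratic (fun v => c * q v).
Proof.
case=> qZ qB; split=> [d v|d u v w]; first by rewrite qZ; ring.
by have := qB d u v w; rewrite /polar -!mulrBr => ->; ring.
Qed.

Lemma is_quadratic_sum (F : fieldType) (V : vectType F) (I : finType)
    (P : pred I) (q : I -> V -> F) :
  (forall i, is_quadratic (q i)) -> is_quadratic (fun v => \sum_(i | P i) q i v).
Proof.
move=> qP; split=> [c v|c u v w].
  by rewrite mulr_sumr; apply: eq_bigr => i _; case: (qP i).
rewrite /polar -!sumrB mulr_sumr -big_split; apply: eq_bigr => i _.
by case: (qP i) => _; apply.
Qed.

Lemma is_quadratic_add (F : fieldType) (V : vectType F) (q1 q2 : V -> F) :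
  is_quadratic q1 -> is_quadratic q2 -> is_quadratic (fun v => q1 v + q2 v).
Proof.
move=> [Z1 B1] [Z2 B2]; split=> [c v|c u v w]; first by rewrite Z1 Z2 mulrDr.
have := congr2 +%R (B1 c u v w) (B2 c u v w); rewrite /polar => E.
by apply: etrans (etrans E _); ring.
Qed.

Lemma is_quadratic_comp (F : fieldType) (V W : vectType F) (l : V -> W)
    (q : W -> F) :
  linear l -> is_quadratic q -> is_quadratic (fun v => q (l v)).
Proof.
move=> ll [qZ qB].
have l0 : l 0 = 0.
  by have := ll 1 0 0; rewrite !scale1r addr0 => /eqP;
    rewrite eq_sym -subr_eq0 addrK => /eqP.
have lZ c v : l (c *: v) = c *: l v by have := ll c v 0; rewrite l0 !addr0.
have lD u v : l (u + v) = l u + l v by have := ll 1 u v; rewrite !scale1r.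
split=> [c v|c u v w]; first by rewrite lZ qZ.
by rewrite /polar !lD lZ; exact: qB.
Qed.

Lemma binary_subproof (F : fieldType) (a b : F) :
  is_quadratic
    (fun v : F^o * F^o => a * v.1 ^+ 2 + v.1 * v.2 + b * v.2 ^+ 2).
Proof.
split=> [c [x y]|c [x y] [z t] [r s]]; rewrite /polar /=.
  rewrite -![_ *: _]/(_ * _); ring.
rewrite -![_ *: _]/(_ * _); ring.
Qed.

(* The form [a, b]. *)
Definition binary (F : fieldType) (a b : F) : quadform (F^o * F^o)%type :=
  QuadForm (binary_subproof a b).

Definition scaled (F : fieldType) (V : vectType F) (c : F) (q : quadform V) :
    quadform V :=
  QuadForm (is_quadratic_scale c (qvalP q)).

Lemma orth_sum_subproof (F : fieldType) (V : vectType F) (I : finType)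
    (q : I -> quadform V) :
  is_quadratic (fun v : {ffun I -> V} => \sum_i q i (v i)).
Proof.
apply: is_quadratic_sum => i.
apply: (@is_quadratic_comp _ _ _ (fun v : {ffun I -> V} => v i) (q i)) (qvalP _).
by move=> c u v; rewrite !ffunE.
Qed.

Definition orth_sum (F : fieldType) (V : vectType F) (I : finType)
    (q : I -> quadform V) : quadform {ffun I -> V} :=
  QuadForm (orth_sum_subproof q).

Definition isometric (F : fieldType) (V W : vectType F)
    (q : quadform V) (q' : quadform W) : Prop :=
  exists g : {linear V -> W}, bijective g /\ (forall v, q' (g v) = q v).

Definition isotropic (F : fieldType) (V : vectType F) (q : quadform V) : Prop :=
  exists2 v : V, v != 0 & q v = 0.

Definition anisotropic (F : fieldType) (V : vectType F) (q : quadform V) :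
    Prop :=
  ~ isotropic q.

Definition hyperbolic (F : fieldType) (V : vectType F) (q : quadform V) : Prop :=
  exists k : nat, isometric q (orth_sum (fun _ : 'I_k => binary (0 : F) 0)).

Definition pfister (F : fieldType) (m : nat) (b : 'I_m -> F) (a : F) :
    quadform {ffun {set 'I_m} -> (F^o * F^o)%type} :=
  orth_sum (fun I : {set 'I_m} => scaled (\prod_(i in I) b i) (binary 1 a)).

Definition is_pfister (n : nat) (F : fieldType) (V : vectType F)
    (q : quadform V) : Prop :=
  (0 < n)%N /\
  exists (b : 'I_n.-1 -> F) (a : F),
    (forall i, b i != 0) /\ isometric q (pfister b a).

Lemma scalar_ext_subproof (F E : fieldType) (f : {rmorphism F -> E})
    (V : vectType F) (q : quadform V) (e : 'I_(\dim {:V}) -> V) :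
  is_quadratic (fun x : 'rV[E]_(\dim {:V}) =>
    \sum_(i < \dim {:V}) f (q (e i)) * (x 0 i * x 0 i) +
    \sum_(i < \dim {:V}) \sum_(j < \dim {:V} | (i < j)%N)
      f (polar q (e i) (e j)) * (x 0 i * x 0 j)).
Proof.
have P i j c : is_quadratic (fun x : 'rV[E]_(\dim {:V}) => c * (x 0 i * x 0 j)).
  by apply: is_quadratic_scale; apply: is_quadratic_mul => d u v; rewrite !mxE.
apply: is_quadratic_add; first by apply: is_quadratic_sum.
by apply: is_quadratic_sum => i; apply: is_quadratic_sum.
Qed.

(* The space of [scalar_ext f q] is E (x) V, in the coordinates given by the
   F-basis [vbasis fullv] of V; by [scalar_ext_map] below it extends q, and
   its polar form is the E-bilinear extension of that of q. *)
Definition scalar_ext (F E : fieldType) (f : {rmorphism F -> E})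
    (V : vectType F) (q : quadform V) : quadform 'rV[E]_(\dim {:V}) :=
  QuadForm (scalar_ext_subproof f q (fun i => (vbasis {:V})`_i)).

Lemma quadratic_sum (F : fieldType) (V : vectType F) (q : quadform V) (n : nat)
    (x : 'I_n -> F) (e : 'I_n -> V) :
  q (\sum_i x i *: e i) =
    \sum_i q (e i) * (x i * x i) +
    \sum_(i < n) \sum_(j < n | (i < j)%N) polar q (e i) (e j) * (x i * x j).
Proof.
case: (qvalP q) => qZ qB.
have q0 : q 0 = 0 by rewrite -(scale0r 0) qZ expr2 !mul0r.
have B0 w : polar q 0 w = 0 by rewrite /polar add0r q0 subr0 subrr.
have Bsym u v : polar q u v = polar q v u by rewrite /polar [u + v]addrC; ring.
elim: n x e => [|n IH] x e; first by rewrite !big_ord0 addr0.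
have Bs (w : V) : polar q (\sum_(i < n) x (lift ord0 i) *: e (lift ord0 i)) w =
    \sum_(i < n) x (lift ord0 i) * polar q (e (lift ord0 i)) w.
  by elim/big_rec2: _ => [//|i y1 y2 _ <-]; rewrite qB.
have qD u v : q (u + v) = q u + q v + polar q u v by rewrite /polar; ring.
rewrite !big_ord_recl /= qD qZ IH.
rewrite [X in _ + _ + X]Bsym.
have -> : polar q (\sum_(i < n) x (lift ord0 i) *: e (lift ord0 i))
             (x ord0 *: e ord0) =
   \sum_(j < n.+1 | (0 < j)%N) polar q (e ord0) (e j) * (x ord0 * x j).
  rewrite [RHS]big_mkcond [RHS]big_ord_recl /= add0r Bs; apply: eq_bigr => i _.
  rewrite Bsym -[x ord0 *: e ord0]addr0 qB B0 addr0 /=; ring.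
have -> : \sum_(i < n) \sum_(j < n.+1 | (lift ord0 i < j)%N)
     polar q (e (lift ord0 i)) (e j) * (x (lift ord0 i) * x j) =
   \sum_(i < n) \sum_(j < n | (i < j)%N)
     polar q (e (lift ord0 i)) (e (lift ord0 j)) *
       (x (lift ord0 i) * x (lift ord0 j)).
  apply: eq_bigr => i _; rewrite [LHS]big_mkcond [LHS]big_ord_recl /= add0r.
  by rewrite [RHS]big_mkcond; apply: eq_bigr.
rewrite expr2; ring.
Qed.

Lemma scalar_ext_map (F E : fieldType) (f : {rmorphism F -> E})
    (V : vectType F) (q : quadform V) (v : V) :
  scalar_ext f q (\row_i f (coord (vbasis {:V}) i v)) = f (q v).
Proof.
rewrite [in RHS](coord_vbasis (memvf v)) quadratic_sum rmorphD !rmorph_sum /=.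
congr (_ + _); apply: eq_bigr => i _; first by rewrite mxE !rmorphM.
by rewrite rmorph_sum; apply: eq_bigr => j _; rewrite !mxE !rmorphM.
Qed.

Definition totally_separably_linked_to (F : fieldType) (V W : vectType F)
    (q : quadform V) (q' : quadform W) : Prop :=
  forall K : fieldExtType F, \dim {:K} = 2%N -> separable 1 {:K} ->
    hyperbolic (scalar_ext (in_alg K) q) ->
    hyperbolic (scalar_ext (in_alg K) q').

Definition totally_inseparably_linked_to (F : fieldType) (V W : vectType F)
    (q : quadform V) (q' : quadform W) : Prop :=
  forall K : fieldExtType F, \dim {:K} = 2%N -> ~~ separable 1 {:K} ->
    hyperbolic (scalar_ext (in_alg K) q) ->
    hyperbolic (scalar_ext (in_alg K) q').

Definition totally_separably_linked (F : fieldType) (V W : vectType F)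
    (q : quadform V) (q' : quadform W) : Prop :=
  totally_separably_linked_to q q' /\ totally_separably_linked_to q' q.

Definition totally_inseparably_linked (F : fieldType) (V W : vectType F)
    (q : quadform V) (q' : quadform W) : Prop :=
  totally_inseparably_linked_to q q' /\ totally_inseparably_linked_to q' q.

(* Main.v *)
(* Write pi' = [1,d] + psi, with base vector e0 representing 1. For x in F and
   eps in {0,1} such that X^2 + eps X + x has no root, let E be the function
   field of the affine quadric u^2 + eps u = x + eps d + psi(w), w generic.
   Over E the vector u e0 + eps y0 + w of pi' has value x and pairs to eps with
   e0, so the quadratic extension defined by (x, eps) splits pi'_E. If an
   anisotropic Pfister form q became isotropic over E, then by roundness it
   would represent eps d + x + psi(w) over F(w) compatibly with e0, and the
   Cassels-Pfister theorem would embed psi into q over F; for q = pi' a Witt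
   extension gives a root of X^2 + eps X + x. For pi, and for the
   non-isometry of pi and pi', one passes to an extension of F over which pi'
   is isotropic and pi is not, where the same argument applies.
   Resolving all pairs (x, eps) by ultraproducts and a countable tower yields an
   E all of whose quadratic extensions split both forms; they are then totally
   linked, although not isometric. *)
Require Import Defs.
From mathcomp Require Import boolp classical_sets filter.
From mathcomp Require Import all_boot all_order all_algebra all_field.
From mathcomp Require Import ring zify.
From HB Require Import structures.

Set Implicit Arguments.
Unset Strict Implicit.
Unset Printing Implicit Defensive.

Import GRing.Theory.
Local Open Scope ring_scope.

(** * Quadratic forms as matrices *)

(** A quadratic extension in characteristic 2 is generated by t with t^2 + eps t = x and eps in
    {0,1}; it splits a Pfister form as soon as that form has a vector of value x pairing to eps with
    e0. Recording the pairing treats separable and inseparable extensions at once. It is also why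
    Cassels-Pfister is proved with linear side conditions: these carry the pairing with e0, and each
    eliminated variable adds one more condition of the same kind. The obstacle is to adjoin such a
    vector for one form while keeping both forms anisotropic and non-isometric. A field where pi is
    anisotropic and pi' isotropic settles the anisotropy of pi and the non-isometry together, since
    both pass to subfields; hence each new field is built inside such a larger one. There n > 1
    enters: a zero of pi' orthogonal to e0 is needed, and it exists because a totally isotropic
    subspace of dimension 2^(n-1) > 1 meets a hyperplane. Anisotropy and non-isometry concern
    finitely many field elements at a time, so they survive ultraproducts. *)

Section MatrixForms.
Variables (R : comNzRingType) (N : nat).
Implicit Types (A B : 'M[R]_N) (x y z : 'rV[R]_N).

Definition qf A x : R := (x *m A *m x^T) 0 0.
Definition bf A x y : R := (x *m (A + A^T) *m y^T) 0 0.

Lemma mx11_tr (M : 'M[R]_1) : M^T = M.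
Proof. by apply/matrixP=> i j; rewrite !ord1 mxE. Qed.

Lemma bfC A x y : bf A x y = bf A y x.
Proof.
rewrite /bf -[_ *m y^T]mx11_tr !trmx_mul trmxK linearD /= trmxK mulmxA.
by rewrite [A^T + A]addrC.
Qed.

Lemma qfD A x y : qf A (x + y) = qf A x + qf A y + bf A x y.
Proof.
rewrite /qf /bf linearD /= !(mulmxDl, mulmxDr).
have -> : y *m A *m x^T = x *m A^T *m y^T.
  by rewrite -[LHS]mx11_tr !trmx_mul trmxK mulmxA.
by rewrite !mxE; ring.
Qed.

Lemma qfZ A c x : qf A (c *: x) = c ^+ 2 * qf A x.
Proof. by rewrite /qf linearZ /= -!scalemxAl -scalemxAr !mxE; ring. Qed.

Lemma qf0 A : qf A 0 = 0.
Proof. by rewrite /qf !mul0mx mxE. Qed.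

Lemma bfDl A x y z : bf A (x + y) z = bf A x z + bf A y z.
Proof. by rewrite /bf !mulmxDl mxE. Qed.

Lemma bfDr A x y z : bf A x (y + z) = bf A x y + bf A x z.
Proof. by rewrite bfC bfDl !(bfC A x). Qed.

Lemma bfZl A c x y : bf A (c *: x) y = c * bf A x y.
Proof. by rewrite /bf -!scalemxAl mxE. Qed.

Lemma bfZr A c x y : bf A x (c *: y) = c * bf A x y.
Proof. by rewrite bfC bfZl bfC. Qed.

Lemma bf0l A x : bf A 0 x = 0.
Proof. by rewrite /bf !mul0mx mxE. Qed.

Lemma bf0r A x : bf A x 0 = 0.
Proof. by rewrite bfC bf0l. Qed.

Lemma bfxx A x : bf A x x = qf A x *+ 2.
Proof.
rewrite /bf /qf !(mulmxDl, mulmxDr).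
have -> : x *m A^T *m x^T = x *m A *m x^T.
  by rewrite -[LHS]mx11_tr !trmx_mul !trmxK mulmxA.
by rewrite mxE mulr2n.
Qed.

Lemma qf_delta A i : qf A (delta_mx 0 i) = A i i.
Proof. by rewrite /qf -rowE trmx_delta -colE !mxE. Qed.

Lemma bf_delta A i j : bf A (delta_mx 0 i) (delta_mx 0 j) = A i j + A j i.
Proof. by rewrite /bf -rowE trmx_delta -colE !mxE. Qed.

Lemma bfE A x y : x *m ((A + A^T) *m y^T) = (bf A x y)%:M.
Proof. by rewrite mulmxA [LHS]mx11_scalar. Qed.

End MatrixForms.

Lemma qf_mul (R : comNzRingType) M N (A : 'M[R]_N) (P : 'M[R]_(M, N)) x :
  qf A (x *m P) = qf (P *m A *m P^T) x.
Proof. by rewrite /qf trmx_mul !mulmxA. Qed.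

Lemma bf_mul (R : comNzRingType) M N (A : 'M[R]_N) (P : 'M[R]_(M, N)) x y :
  bf A (x *m P) (y *m P) = bf (P *m A *m P^T) x y.
Proof.
rewrite /bf !trmx_mul trmxK; congr (_ 0 0).
by rewrite mulmxDr !mulmxDl !mulmxDr !mulmxDl !mulmxA.
Qed.

Lemma qf_map (R S : comNzRingType) (f : {rmorphism R -> S}) N (A : 'M[R]_N) x :
  qf (map_mx f A) (map_mx f x) = f (qf A x).
Proof. by rewrite /qf map_trmx -!map_mxM mxE. Qed.

Lemma bf_map (R S : comNzRingType) (f : {rmorphism R -> S}) N (A : 'M[R]_N) x y :
  bf (map_mx f A) (map_mx f x) (map_mx f y) = f (bf A x y).
Proof. by rewrite /bf !map_trmx -map_mxD -!map_mxM mxE. Qed.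

Lemma qf_block (R : comNzRingType) M N (A : 'M[R]_M) (B : 'M[R]_N) x y :
  qf (block_mx A 0 0 B) (row_mx x y) = qf A x + qf B y.
Proof.
by rewrite /qf mul_row_block tr_row_mx mul_row_col !mulmx0 addr0 add0r mxE.
Qed.

Lemma bf_block (R : comNzRingType) M N (A : 'M[R]_M) (B : 'M[R]_N) x y x' y' :
  bf (block_mx A 0 0 B) (row_mx x y) (row_mx x' y') = bf A x x' + bf B y y'.
Proof.
rewrite /bf tr_block_mx !trmx0 add_block_mx !addr0 mul_row_block tr_row_mx.
by rewrite mul_row_col !mulmx0 addr0 add0r mxE.
Qed.

Lemma qf_scale (R : comNzRingType) N (c : R) (A : 'M[R]_N) x :
  qf (c *: A) x = c * qf A x.
Proof. by rewrite /qf -scalemxAr -scalemxAl mxE. Qed.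

Lemma bf_scale (R : comNzRingType) N (c : R) (A : 'M[R]_N) x y :
  bf (c *: A) x y = c * bf A x y.
Proof. by rewrite /bf linearZ /= -scalerDr -scalemxAr -scalemxAl mxE. Qed.

(* Equality as quadratic forms: a matrix is only determined modulo
   alternating matrices. *)
Definition qeq (R : comNzRingType) N (A B : 'M[R]_N) :=
  A + A^T = B + B^T /\ forall i, A i i = B i i.

Lemma qeqP (R : comNzRingType) N (A B : 'M[R]_N) :
  qeq A B <-> forall x, qf A x = qf B x.
Proof.
split=> [[pAB dAB] x | qAB].
  rewrite (row_sum_delta x); elim/big_rec: _ => [|i y _ IHy]; first by rewrite !qf0.
  by rewrite !qfD IHy !qfZ !qf_delta dAB /bf pAB.
split=> [|i]; last by have := qAB (delta_mx 0 i); rewrite !qf_delta.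
apply/matrixP=> i j; rewrite !mxE.
have := qAB (delta_mx 0 i + delta_mx 0 j).
by rewrite !qfD !qf_delta !bf_delta -!qf_delta !qAB => /addrI.
Qed.

Lemma qeq_bf (R : comNzRingType) N (A B : 'M[R]_N) x y :
  qeq A B -> bf A x y = bf B x y.
Proof. by case=> E _; rewrite /bf E. Qed.

Definition aniso (k : fieldType) N (A : 'M[k]_N) :=
  forall x, qf A x = 0 -> x = 0.

(** [P] is not asked to be invertible: for anisotropic [A] its kernel consists of zeros of [A], so
    it is trivial ([aniso_iso_unit]). *)
Definition iso (k : fieldType) N (A B : 'M[k]_N) :=
  exists P, qeq (P *m B *m P^T) A.

Lemma aniso_iso_unit (k : fieldType) N (A B : 'M[k]_N) : aniso A -> iso A B ->
  exists2 P, P \in unitmx & forall x, qf B (x *m P) = qf A x.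
Proof.
move=> anA [P /qeqP qP]; exists P => [|x]; last by rewrite qf_mul qP.
rewrite -row_free_unit -kermx_eq0; apply/eqP/row_matrixP=> i; rewrite row0.
by apply: anA; rewrite -qP -qf_mul -row_mul mulmx_ker row0 qf0.
Qed.

Lemma aniso_iso_sym (k : fieldType) N (A B : 'M[k]_N) :
  aniso A -> iso A B -> iso B A.
Proof.
move=> anA /(aniso_iso_unit anA)[P Pu qP].
by exists (invmx P); apply/qeqP=> x; rewrite -qf_mul -qP mulmxKV.
Qed.

Lemma iso_aniso (k : fieldType) N (A B : 'M[k]_N) : aniso A -> iso A B -> aniso B.
Proof.
move=> anA /(aniso_iso_unit anA)[P Pu qP] x; rewrite -{1}(mulmxKV Pu x) qP => /anA E.
by rewrite -(mulmxKV Pu x) E mul0mx.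
Qed.

(** * The Cassels-Pfister theorem with linear constraints *)

Lemma qf_sum (R : comNzRingType) N (A : 'M[R]_N) x :
  qf A x = \sum_j (\sum_i x 0 i * A i j) * x 0 j.
Proof. by rewrite /qf mxE; apply: eq_bigr => j _; rewrite !mxE. Qed.

Lemma coefM_top (R : nzRingType) (p q : {poly R}) D :
  (size p <= D.+1)%N -> (size q <= D.+1)%N -> (p * q)`_(D.*2) = p`_D * q`_D.
Proof.
move=> sp sq; rewrite coefM; have lD : (D < D.*2.+1)%N by rewrite ltnS -addnn leq_addr.
rewrite (bigD1 (Ordinal lD)) //=.
have -> : (D.*2 - D = D)%N by lia.
rewrite big1 ?addr0 // => j /eqP jD.
case: (ltngtP j D) => [ltj|gtj|eqj]; last by case: jD; apply: val_inj.
  by rewrite [q`__]nth_default ?mulr0 // (leq_trans sq) //; lia.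
by rewrite [p`__]nth_default ?mul0r // (leq_trans sp).
Qed.

Lemma size_polyMC_leq (R : nzSemiRingType) (p : {poly R}) c :
  (size (p * c%:P)%R <= size p)%N.
Proof.
by rewrite (leq_trans (size_polyMleq _ _)) // size_polyC; case: eqP => _ /=; lia.
Qed.

Section PolyForms.
Variables (k : fieldType) (N : nat) (A : 'M[k]_N).
Hypothesis anA : aniso A.
Let AP := map_mx polyC A.
Implicit Type Y : 'rV[{poly k}]_N.

Lemma qf_coef_top Y D : (forall i, size (Y 0%R i) <= D.+1)%N ->
  (qf AP Y)`_(D.*2) = qf A (map_mx (coefp D) Y).
Proof.
move=> sY; rewrite !qf_sum coef_sum; apply: eq_bigr => j _.
rewrite coefM_top ?coef_sum ?mxE /=; last exact: sY.
  by congr (_ * _); apply: eq_bigr => i _; rewrite !mxE coefMC.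
apply: (leq_trans (size_sum _ _ _)); apply/bigmax_leqP=> i _.
by rewrite [AP _ _]mxE (leq_trans (size_polyMC_leq _ _)).
Qed.

(** Leading terms cannot cancel: the vector of top coefficients is nonzero, hence so is its value,
    which is the top coefficient of [qf AP Y]. The induction lowers a crude common bound one degree
    at a time. *)
Lemma aniso_size Y e :
  (size (qf AP Y) <= e.*2.+1)%N -> forall i, (size (Y 0%R i) <= e.+1)%N.
Proof.
move=> sq; have [D] : exists D, forall i, (size (Y 0%R i) <= D + e.+1)%N.
  exists (\max_i size (Y 0%R i)) => i.
  by rewrite (leq_trans _ (leq_addr _ _)) // (leq_bigmax (F := fun i => size (Y 0%R i))).
elim: D => [|D IHD] // sY; apply: IHD => i.
have q0 : qf A (map_mx (coefp (D + e.+1)) Y) = 0.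
  rewrite -qf_coef_top => [|j]; last by rewrite -addSn.
  by rewrite nth_default // (leq_trans sq) //; lia.
have /rowP/(_ i) := anA q0; rewrite !mxE /= => Yi0.
have := sY i; rewrite addSn leq_eqVlt ltnS => /orP[/eqP sYi|//].
have : lead_coef (Y 0 i) != 0 by rewrite lead_coef_eq0 -size_poly_eq0 sYi.
by rewrite lead_coefE sYi /= Yi0 eqxx.
Qed.

Lemma aniso_poly Y : qf AP Y = 0 -> Y = 0.
Proof.
move=> q0; apply/rowP=> i; rewrite mxE.
have sY : forall j, (size (Y 0%R j) <= 1)%N by apply: (@aniso_size Y 0); rewrite q0 size_poly0.
have := qf_coef_top (D := 0) sY; rewrite q0 coef0 => /esym/anA/rowP/(_ i).
by rewrite !mxE /= => Y0; rewrite (size1_polyC (sY i)) Y0.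
Qed.

(* The two intersection points of the quadric with the line joining X/h to the
   polynomial vector Y closest to it have denominators h and h', and h' has
   smaller degree. *)
Lemma cassels_pfister r (C : 'M[k]_(N, r)) (g : {poly k}) (l : 'rV_r) h X :
  h != 0 -> qf AP X = h ^+ 2 * g -> X *m map_mx polyC C = h *: l ->
  exists2 Y, qf AP Y = g & Y *m map_mx polyC C = l.
Proof.
have [n le_h] := ubnP (size h); elim: n h X le_h => // n IHn h X le_h h0 qX CX.
pose Y := map_mx (fun p => p %/ h) X; pose T := map_mx (fun p => p %% h) X.
have XE : X = h *: Y + T by apply/rowP=> i; rewrite !mxE mulrC -divp_eq.
have sT i : (size (T 0%R i) < size h)%N by rewrite mxE ltn_modp.
(* [T *m C] equals [h] times [l - Y *m C] and has smaller degree than [h], so both vanish. *)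
have YC : Y *m map_mx polyC C = l /\ T *m map_mx polyC C = 0.
  have sTC j : (size ((T *m map_mx polyC C) 0%R j) < size h)%N.
    suff : (size ((T *m map_mx polyC C) 0%R j) <= (size h).-1)%N.
      by have := size_poly_gt0 h; rewrite h0; lia.
    rewrite mxE (leq_trans (size_sum _ _ _)) //; apply/bigmax_leqP=> i _.
    by rewrite [map_mx _ C _ _]mxE (leq_trans (size_polyMC_leq _ _)) //; case: (size h) (sT i).
  have EC : h *: (Y *m map_mx polyC C) + T *m map_mx polyC C = h *: l.
    by rewrite -CX XE mulmxDl -scalemxAl.
  suff YC : Y *m map_mx polyC C = l.
    by split=> //; move: EC; rewrite YC => /eqP; rewrite -subr_eq0 addrAC subrr add0r => /eqP.
  apply/rowP=> j; apply/eqP; rewrite eq_sym -subr_eq0; apply: contraT => nz.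
  have sD : (size (h * (l 0 j - (Y *m map_mx polyC C) 0 j))%R < size h)%N.
    have -> : h * (l 0 j - (Y *m map_mx polyC C) 0 j) = (T *m map_mx polyC C) 0 j.
      move/rowP/(_ j): EC; rewrite [RHS]mxE [LHS]mxE [X in X + _]mxE mulrBr => <-.
      by rewrite addrAC subrr add0r.
    exact: sTC.
  move: sD; rewrite size_mul // ltnNge.
  have : (0 < size (l 0 j - (Y *m map_mx polyC C) 0 j)%R)%N by rewrite lt0n size_poly_eq0.
  by move: (size _) (size h) => u v; lia.
case: YC => YC TC; have [T0|nzT] := eqVneq T 0.
  exists Y => //; apply: (mulfI (expf_neq0 2 h0)).
  by rewrite -qX XE T0 addr0 qfZ.
(* Expanding [qf AP X = h ^+ 2 * g] at [X = h *: Y + T] leaves [qf AP T = h * h']; degrees then give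
   [size h' < size h]. *)
pose h' := h * (g - qf AP Y) - bf AP Y T.
have qT : qf AP T = h * h'.
  by move: qX; rewrite XE qfD qfZ bfZl /h' => E; rewrite mulrBr mulrA -expr2 mulrBr -E; ring.
have qT0 : qf AP T != 0 by apply: contra nzT => /eqP/aniso_poly/eqP.
have h'0 : h' != 0 by apply: contraNneq qT0 => E; rewrite qT E mulr0.
have h1 : (1 < size h)%N.
  rewrite ltnNge; apply: contra nzT => sh; apply/eqP/rowP=> i; rewrite [RHS]mxE.
  by apply/eqP; rewrite -size_poly_eq0 -leqn0 -ltnS (leq_trans (sT i)).
have sqT : (size (qf AP T) <= (size h).-2.*2.+1)%N.
  rewrite qf_sum (leq_trans (size_sum _ _ _)) //; apply/bigmax_leqP=> j _.
  rewrite (leq_trans (size_polyMleq _ _)) //.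
  have leD a b s : (1 < s -> a <= s.-1 -> b < s -> (a + b).-1 <= s.-2.*2.+1)%N by lia.
  apply: leD (sT j) => //.
  rewrite (leq_trans (size_sum _ _ _)) //; apply/bigmax_leqP=> i _.
  by rewrite [AP _ _]mxE (leq_trans (size_polyMC_leq _ _)) //; case: (size h) (sT i).
have lt_h' : (size h' < size h)%N.
  have ltD s s' : (1 < s -> (s + s').-1 <= s.-2.*2.+1 -> s' < s)%N by lia.
  by apply: ltD h1 _; rewrite -size_mul // -qT.
(* Moving along [T] preserves the linear condition because [C] kills [T]. *)
apply: (IHn h' (h' *: Y - (g - qf AP Y) *: T)) => //; first exact: leq_trans lt_h' _.
- rewrite qfD -scaleNr !qfZ bfZl bfZr qT.
  move: (qf AP Y) (bf AP Y T) @h' qT0 qT h'0 lt_h' => y b h' *.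
  by rewrite /h'; ring.
- by rewrite mulmxBl -!scalemxAl YC TC scaler0 subr0.
Qed.

End PolyForms.

(** * Rational function fields *)

Notation tofr := (@FracField.tofrac _).

Lemma fractionP (R : idomainType) (x : {fraction R}) :
  exists n d : R, d != 0 /\ x = tofr n / tofr d.
Proof.
elim/quotW: x => r; exists \n_r, \d_r; split; first exact: denom_ratioP.
apply/(canRL (mulfK _)); first by rewrite tofrac_eq0 denom_ratioP.
rewrite -[_ * _]/(FracField.mul _ _) !piE; apply/eqmodP => /=.
rewrite FracField.equivfE /FracField.mulf.
by rewrite !numden_Ratio ?mulr1 ?oner_eq0 ?denom_ratioP ?mul1r //= mulrC.
Qed.

Lemma common_denom (R : idomainType) N (x : 'rV[{fraction R}]_N) :
  exists2 h : R, h != 0 & exists y, tofr h *: x = map_mx tofr y.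
Proof.
have /fin_all_exists [n /fin_all_exists[d nd]] i := fractionP (x 0 i).
exists (\prod_i d i); first by apply/prodf_neq0 => i _; case: (nd i).
exists (\row_i (n i * \prod_(j | j != i) d j)); apply/rowP=> i; rewrite !mxE.
case: (nd i) => d0 ->; rewrite [\prod_i _](bigD1 i) //= !rmorphM /=.
by field; rewrite tofrac_eq0.
Qed.

Section FracForms.
Variables (k : fieldType) (N : nat) (A : 'M[k]_N).
Hypothesis anA : aniso A.
Let K := {fraction {poly k}}.
Let toK : {rmorphism k -> K} := tofr \o polyC.

Lemma map_tofrac_inj p q (x y : 'M[{poly k}]_(p, q)) : map_mx tofr x = map_mx tofr y -> x = y.
Proof.
move=> /matrixP E; apply/matrixP=> i j; have := E i j; rewrite !mxE => /eqP.
by rewrite tofrac_eq => /eqP.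
Qed.

Lemma aniso_frac : aniso (map_mx toK A).
Proof.
move=> x qx; have [h h0 [y xy]] := common_denom x.
have th0 : tofr h != 0 by rewrite tofrac_eq0.
suff y0 : y = 0.
  by apply: (scalerI th0); rewrite xy y0 scaler0 map_mx0.
apply: (aniso_poly anA); apply/eqP; rewrite -tofrac_eq0 -qf_map -map_mx_comp -xy.
by rewrite qfZ qx mulr0.
Qed.

Lemma cassels_pfister_frac r (C : 'M[k]_(N, r)) g (l : 'rV_r) X :
  qf (map_mx toK A) X = tofr g -> X *m map_mx toK C = map_mx tofr l ->
  exists2 Y, qf (map_mx polyC A) Y = g & Y *m map_mx polyC C = l.
Proof.
move=> qX XC; have [h h0 [y xy]] := common_denom X.
apply: (cassels_pfister anA h0 (X := y)).
  apply/eqP; rewrite -tofrac_eq rmorphM rmorphXn /= -qX -qfZ xy.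
  by rewrite -qf_map -map_mx_comp.
apply: map_tofrac_inj; rewrite map_mxM -map_mx_comp -xy -scalemxAl XC.
by apply/rowP=> i; rewrite !mxE rmorphM.
Qed.
End FracForms.

Fixpoint ratfun (k : fieldType) m : fieldType :=
  if m is m'.+1 then {fraction {poly (ratfun k m')}} else k.

Definition ratS (k : fieldType) m : {rmorphism ratfun k m -> ratfun k m.+1} :=
  tofr \o polyC.

Definition ratX (k : fieldType) m : ratfun k m.+1 := tofr 'X.

Fixpoint ratC (k : fieldType) m : {rmorphism k -> ratfun k m} :=
  if m is m'.+1 then ratS k m' \o ratC k m' else idfun.

(** The newest variable stands first, so that a form in [m.+1] variables splits as a [1 + m] block
    matrix in step with the tower of fields. *)
Fixpoint genpt (k : fieldType) m : 'rV[ratfun k m]_m :=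
  if m is m'.+1 then row_mx (ratX k m')%:M (map_mx (ratS k m') (genpt k m')) else 0.

(** * Reflections in characteristic 2 and removal of variables *)

Lemma addvv (k : fieldType) (ch2 : 2%N \in [pchar k]) (V : lmodType k) (v : V) : v + v = 0.
Proof. by rewrite -{1 2}(scale1r v) -scalerDl addrr_pchar2 // scale0r. Qed.

Lemma oppv (k : fieldType) (ch2 : 2%N \in [pchar k]) (V : lmodType k) (v : V) : - v = v.
Proof. by apply/eqP; rewrite eq_sym -addr_eq0 addvv. Qed.

(** Reflection in [r = y + e], or the identity if [r = 0]; equal values give [qf A r = bf A y r].
    Vectors move only by multiples of [r], so those orthogonal to [r] stay fixed, and a linear
    condition that agrees on [y] and [e] is preserved. *)
Lemma reflection (k : fieldType) (ch2 : 2%N \in [pchar k]) N (A : 'M[k]_N) y e :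
  aniso A -> qf A y = qf A e ->
  exists s : 'M_N, [/\ forall x, qf A (x *m s) = qf A x, y *m s = e,
    forall x, bf A x y = bf A x e -> x *m s = x
    & forall r (C : 'M_(N, r)), y *m C = e *m C -> s *m C = C].
Proof.
move=> anA qye; pose r := y + e; have [r0|r0] := eqVneq r 0.
  exists 1%:M; split=> [x||x _|p C _]; rewrite ?mulmx1 ?mul1mx //.
  by apply/eqP; rewrite -subr_eq0 (oppv ch2) -/r r0.
have qr0 : qf A r != 0 by apply: contra r0 => /eqP/anA/eqP.
have qr : qf A r = bf A y r by rewrite /r qfD bfDr bfxx -qye mulrn_pchar // addrr_pchar2.
have sE x : x *m (1%:M + (qf A r)^-1 *: ((A + A^T) *m r^T *m r)) =
            x + (bf A x r / qf A r) *: r.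
  rewrite mulmxDr mulmx1 -scalemxAr !mulmxA -(mulmxA x) bfE mul_scalar_mx.
  by rewrite scalerA mulrC.
exists (1%:M + (qf A r)^-1 *: ((A + A^T) *m r^T *m r)).
split=> [x||x bx|p C yC].
- rewrite sE qfD qfZ bfZr -addrA.
  have -> : (bf A x r / qf A r) ^+ 2 * qf A r = bf A x r / qf A r * bf A x r by field.
  by rewrite addrr_pchar2 // addr0.
- by rewrite sE -qr divff // scale1r /r addrA (addvv ch2) add0r.
- by rewrite sE bfDr bx addrr_pchar2 // mul0r scale0r addr0.
apply/row_matrixP=> i; rewrite row_mul [row i (_ + _)]rowE sE mulmxDl -scalemxAl.
by rewrite mulmxDl yC (addvv ch2) scaler0 addr0 -rowE.
Qed.

Lemma map_ratCS (k : fieldType) m p q (B : 'M[k]_(p, q)) :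
  map_mx (ratC k m.+1) B = map_mx (ratS k m) (map_mx (ratC k m) B).
Proof. exact: map_mx_comp. Qed.

Lemma aniso_ratfun (k : fieldType) N (A : 'M[k]_N) m :
  aniso A -> aniso (map_mx (ratC k m) A).
Proof.
move=> anA; elim: m => [|m IHm]; first by rewrite map_mx_id.
by rewrite map_ratCS; exact: aniso_frac.
Qed.

(** Cassels-Pfister makes a representation of a constant polynomial in the top variable, and
    [aniso_size] makes it constant; so the variables drop out one by one. *)
Lemma specialize (k : fieldType) N (A : 'M[k]_N) r (C : 'M_(N, r)) m c l X :
    aniso A -> qf (map_mx (ratC k m) A) X = ratC k m c ->
    X *m map_mx (ratC k m) C = map_mx (ratC k m) l ->
  exists2 e, qf A e = c & e *m C = l.
Proof.
move=> anA; elim: m => [|m IHm] in X *.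
  by rewrite !map_mx_id // => qX CX; exists X.
rewrite !map_ratCS [map_mx (ratS _ _) (map_mx _ l)]map_mx_comp => qX XC.
have [Y qY YC] := cassels_pfister_frac (aniso_ratfun (m := m) anA) qX XC.
have sY : forall i, (size (Y 0%R i) <= 1)%N.
  by apply: (@aniso_size _ _ _ (aniso_ratfun (m := m) anA) Y 0); rewrite qY size_polyC; case: eqP.
have YE : Y = map_mx polyC (map_mx (coefp 0) Y).
  by apply/rowP=> i; rewrite !mxE /= [LHS]size1_polyC.
apply: (IHm (map_mx (coefp 0) Y)).
  by apply: polyC_inj; rewrite -qY -qf_map -YE.
have E : map_mx polyC (map_mx (coefp 0) Y *m map_mx (ratC k m) C) =
  map_mx polyC (map_mx (ratC k m) l) by rewrite map_mxM -YE.
apply/matrixP=> i j; apply: polyC_inj; move/matrixP/(_ i j): E.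
by rewrite [LHS]mxE [RHS]mxE.
Qed.

Lemma qf_block_row (R : comNzRingType) m (b : R) (u : 'rV_m) (d : 'cV_m) (B : 'M_m) a x :
  qf (block_mx b%:M u d B : 'M_(1 + m)) (row_mx a%:M x) =
  a ^+ 2 * b + a * (x *m (d + u^T)) 0 0 + qf B x.
Proof.
rewrite /qf mul_row_block tr_row_mx mul_row_col tr_scalar_mx.
rewrite !mul_mx_scalar !mul_scalar_mx mulmxDl mulmxDr -scalemxAl.
by rewrite -[u *m x^T]mx11_tr trmx_mul trmxK !mxE /= mulr1n; ring.
Qed.

(** * The subform theorem *)

Lemma poly_deg2_inj (R : nzRingType) (a b c a' b' c' : R) :
  a%:P + b%:P * 'X + c%:P * 'X^2 = a'%:P + b'%:P * 'X + c'%:P * 'X^2 ->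
  [/\ a = a', b = b' & c = c'].
Proof.
move=> /polyP E; split; [have := E 0%N | have := E 1%N | have := E 2%N];
by rewrite !coefD !coefCM !coefXn !coefX !coefC /= ?(mulr0, mulr1, addr0, add0r).
Qed.

Lemma poly_deg1_mx_inj (R : nzRingType) p q (a b a' b' : 'M[R]_(p, q)) :
  map_mx polyC a + 'X *: map_mx polyC b = map_mx polyC a' + 'X *: map_mx polyC b' ->
  a = a' /\ b = b'.
Proof.
move=> /matrixP E; split; apply/matrixP=> i j; have /polyP F := E i j.
  by have := F 0%N; rewrite !mxE !coefD !coefXM !coefC /= !addr0.
by have := F 1%N; rewrite !mxE !coefD !coefXM !coefC /= !add0r.
Qed.

Lemma isometry_bf (R : comNzRingType) N (A s : 'M[R]_N) x y :
  (forall x, qf A (x *m s) = qf A x) -> bf A (x *m s) (y *m s) = bf A x y.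
Proof.
by move=> qs; rewrite bf_mul; apply: qeq_bf; apply/qeqP=> z; rewrite -qf_mul.
Qed.

Lemma map_mxE (aT rT : Type) (f : aT -> rT) m n (M : 'M_(m, n)) i j :
  map_mx f M i j = f (M i j).
Proof. by rewrite mxE. Qed.

Lemma mul_row_scal (R : comNzRingType) m n (t : R) (w : 'rV_m) (M : 'M_(1 + m, n)) :
  row_mx t%:M w *m M = t *: usubmx M + w *m dsubmx M.
Proof. by rewrite -{1}(vsubmxK M) mul_row_col mul_scalar_mx. Qed.

Lemma qf_row_scal (R : comNzRingType) m (t : R) w (B : 'M_(1 + m)) :
  qf B (row_mx t%:M w) =
  t ^+ 2 * ulsubmx B 0 0 + t * (w *m (dlsubmx B + (ursubmx B)^T)) 0 0 + qf (drsubmx B) w.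
Proof.
rewrite -{1}(submxK B) [ulsubmx B]mx11_scalar qf_block_row.
by rewrite -mx11_scalar.
Qed.

Lemma form_row_map (K S : comNzRingType) (phi : {rmorphism K -> S}) m t w
    (g : 'cV[K]_(1 + m)) (B : 'M[K]_(1 + m)) :
  (row_mx t%:M (map_mx phi w) *m map_mx phi g) 0 0
    + qf (map_mx phi B) (row_mx t%:M (map_mx phi w)) =
  phi ((w *m dsubmx g) 0 0 + qf (drsubmx B) w) +
  phi (usubmx g 0 0 + (w *m (dlsubmx B + (ursubmx B)^T)) 0 0) * t +
  phi (ulsubmx B 0 0) * t ^+ 2.
Proof.
rewrite mul_row_scal qf_row_scal -map_usubmx -map_dsubmx.
rewrite -map_ulsubmx -map_dlsubmx -map_ursubmx -map_drsubmx map_trmx.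
rewrite -map_mxD -!map_mxM qf_map.
by rewrite [(_ + _ : 'M__) 0 0]mxE [(_ *: _ : 'M__) 0 0]mxE !map_mxE !rmorphD /=; ring.
Qed.

Lemma mul_row_map (K S : comNzRingType) (phi : {rmorphism K -> S}) m n t w
    (M : 'M[K]_(1 + m, n)) :
  row_mx t%:M (map_mx phi w) *m map_mx phi M =
  map_mx phi (w *m dsubmx M) + t *: map_mx phi (usubmx M).
Proof. by rewrite mul_row_scal map_mxM map_dsubmx map_usubmx addrC. Qed.

(** Reflections put the rows of [L] in place one at a time. [x0] and the rows already placed are
    orthogonal to the difference in which the next reflection is taken, so it fixes them. *)
Lemma witt_extension (k : fieldType) (ch2 : 2%N \in [pchar k]) N (A : 'M[k]_N) x0
    p (L L' : 'M_(p, N)) :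
  aniso A -> (forall v, qf A (v *m L) = qf A (v *m L')) ->
  (forall v, bf A x0 (v *m L) = bf A x0 (v *m L')) ->
  exists s, [/\ forall x, qf A (x *m s) = qf A x, x0 *m s = x0 & L *m s = L'].
Proof.
move=> anA qL b0.
have bL i j : bf A (row i L) (row j L) = bf A (row i L') (row j L').
  rewrite !rowE !bf_mul; apply: qeq_bf; apply/qeqP=> v; rewrite -!qf_mul; exact: qL.
suff: forall j, exists s, [/\ forall x, qf A (x *m s) = qf A x, x0 *m s = x0 &
    forall i : 'I_p, (i < j)%N -> row i L *m s = row i L'].
  move=> /(_ p)[s [qs s0 sL]]; exists s; split=> //.
  by apply/row_matrixP=> i; rewrite row_mul sL.
elim=> [|j [s [qs s0 sL]]]; first by exists 1%:M; split=> [x||]; rewrite ?mulmx1.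
have [lt_jp|le_pj] := ltnP j p; last first.
  by exists s; split=> // i _; apply: sL; rewrite (leq_trans (ltn_ord i)).
pose J := Ordinal lt_jp.
have [|t [qt tJ tfix _]] := reflection ch2 (y := row J L *m s) (e := row J L') anA.
  by rewrite qs !rowE qL.
exists (s *m t); split=> [x||i]; first by rewrite mulmxA qt qs.
  rewrite mulmxA s0 tfix // -{1}s0 (isometry_bf _ _ qs) !rowE; exact: b0.
rewrite ltnS leq_eqVlt => /orP[/eqP eij|lt_ij]; rewrite mulmxA.
  by have -> : i = J by [apply: val_inj]; rewrite tJ.
by rewrite sL // tfix // -{1}sL // (isometry_bf _ _ qs) bL.
Qed.

(** A representation at the generic point becomes an affine one, [Y + v L], over [k]. In the top
    variable t it reads Y0 + t Y1 with [Y1] of constant value, and a reflection turns [Y1] into a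
    vector [e] over [k]. The coefficient of t then prescribes the pairing of [Y0] with [e]. This is
    a further column of [C], which is why the induction carries an arbitrary [C]. *)
Theorem subform (k : fieldType) (ch2 : 2%N \in [pchar k]) N (A : 'M[k]_N) m :
    aniso A ->
  forall r (C : 'M[k]_(N, r)) c (g : 'cV_m) (B : 'M_m) l0 (l1 : 'M_(m, r)) X,
    qf (map_mx (ratC k m) A) X =
      ratC k m c + (genpt k m *m map_mx (ratC k m) g) 0 0
      + qf (map_mx (ratC k m) B) (genpt k m) ->
    X *m map_mx (ratC k m) C =
      map_mx (ratC k m) l0 + genpt k m *m map_mx (ratC k m) l1 ->
  exists Y L, [/\ qf A Y = c, Y *m C = l0, L *m C = l1,
     forall v, bf A Y (v *m L) = (v *m g) 0 0 & forall v, qf A (v *m L) = qf B v].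
Proof.
move=> anA; elim: m => [|m IHm] r C c g B l0 l1 X.
  rewrite !map_mx_id // !thinmx0 mul0mx mxE qf0 !addr0 mul0mx addr0 => qX XC.
  exists X, 0; split=> // [|v|v]; first by rewrite flatmx0 [RHS]flatmx0.
    by rewrite mulmx0 bf0r flatmx0 mulmx0 mxE.
  by rewrite mulmx0 qf0 [v]thinmx0 qf0.
rewrite !map_ratCS.
rewrite (_ : genpt k m.+1 = row_mx (ratX k m)%:M (map_mx (ratS k m) (genpt k m))) //.
rewrite (_ : ratC k m.+1 c = ratS k m (ratC k m c)) //.
set f := ratC k m; set w := genpt k m in IHm *.
rewrite -addrA (@form_row_map _ _ (ratS k m) m) (@mul_row_map _ _ (ratS k m) m).
rewrite -!map_dsubmx -!map_usubmx.
rewrite -map_ulsubmx -map_dlsubmx -map_ursubmx -map_drsubmx map_trmx -map_mxD.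
pose G := (f c + ((w *m map_mx f (dsubmx (g : 'cV_(1 + m)))) 0 0
     + qf (map_mx f (drsubmx (B : 'M_(1 + m)))) w))%:P +
  (f (usubmx (g : 'cV_(1 + m)) 0 0) +
     (w *m map_mx f (dlsubmx (B : 'M_(1 + m)) + (ursubmx (B : 'M_(1 + m)))^T)) 0 0)%:P * 'X
   + (f (ulsubmx (B : 'M_(1 + m)) 0 0))%:P * 'X^2.
pose l := map_mx polyC (map_mx f l0 + w *m map_mx f (dsubmx (l1 : 'M_(1 + m, r))))
   + 'X *: map_mx polyC (map_mx f (usubmx (l1 : 'M_(1 + m, r)))).
rewrite !map_mxE (_ : _ + _ = tofr G); last first.
  by rewrite /G !(rmorphD, rmorphM, rmorphXn) /= !addrA.
move=> qX; rewrite (_ : _ + _ = map_mx tofr l) => [XC|]; last first.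
  apply/rowP=> i; rewrite !mxE; by rewrite !(rmorphD, rmorphM) /= addrA.

have anK := aniso_ratfun (m := m) anA.
have [Y qY YC] := cassels_pfister_frac anK qX XC.
(* The represented polynomial has degree at most 2 in the top variable, so [Y] has degree at most
   1. *)
have sY : forall i, (size (Y 0%R i) <= 2)%N.
  apply: (@aniso_size _ _ _ anK Y 1); rewrite qY.
  apply: (leq_trans (size_polyD _ _)); rewrite geq_max; apply/andP; split; last first.
    by rewrite mulrC (leq_trans (size_polyMC_leq _ _)) // size_polyXn.
  apply: (leq_trans (size_polyD _ _)); rewrite geq_max; apply/andP; split; last first.
    by rewrite mulrC (leq_trans (size_polyMC_leq _ _)) // size_polyX.
  by rewrite (leq_trans (size_polyC_leq1 _)).
pose Y0 := map_mx (coefp 0) Y; pose Y1 := map_mx (coefp 1) Y.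
have YE : Y = map_mx polyC Y0 + 'X *: map_mx polyC Y1.
  apply/rowP=> i; rewrite !mxE /=; apply/polyP=> j.
  rewrite coefD coefXM !coefC; case: j => [|[|j]] /=; rewrite ?addr0 ?add0r //.
  by rewrite nth_default // (leq_trans (sY i)).
move: qY; rewrite YE qfD qfZ bfZr !qf_map bf_map /G.
rewrite addrAC [_ ^+ 2 * _]mulrC ['X * _]mulrC => /poly_deg2_inj[qY0 bY01 qY1].
move: YC; rewrite YE mulmxDl -scalemxAl -!map_mxM => /poly_deg1_mx_inj[Y0C Y1C].
(* The value of [Y1] and its linear conditions come from [k], so some [e] over [k] shares them. *)
have [e qe eC] := specialize anA qY1 Y1C.
have [|s [qs sY1 _ sC]] := reflection (rmorph_pchar f ch2) (e := map_mx f e) (y := Y1) anK.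
  by rewrite qf_map qe.
have Y1e : Y1 *m map_mx f C = map_mx f e *m map_mx f C by rewrite Y1C -map_mxM eC.
have [] := IHm _ (row_mx C ((A + A^T) *m e^T)) c (dsubmx (g : 'cV_(1 + m)))
  (drsubmx (B : 'M_(1 + m))) (row_mx l0 (usubmx (g : 'cV_(1 + m))))
  (row_mx (dsubmx (l1 : 'M_(1 + m, r)))
     (dlsubmx (B : 'M_(1 + m)) + (ursubmx (B : 'M_(1 + m)))^T)) (Y0 *m s).
- by rewrite qs qY0 addrA.
- rewrite !map_row_mx !mul_mx_row add_row_mx -!mulmxA (sC _ _ Y1e) Y0C; congr row_mx.
  rewrite map_mxM map_mxD -!map_trmx mulmxA bfE -sY1 (isometry_bf _ _ qs) bY01.
  by apply/matrixP=> i j; rewrite !ord1 mxE [RHS]mxE map_mxE mulr1n.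
move=> Z [L [qZ ZC LC bZ qL]]; exists Z, (col_mx e L : 'M_(1 + m, N)).
move: ZC LC; rewrite !mul_mx_row => /eq_row_mx[ZC Ze] /eq_row_mx[LC Le].
have vE (v : 'rV[k]_(1 + m)) : v = row_mx (v 0 0)%:M (rsubmx v).
  by rewrite -[LHS]hsubmxK [lsubmx v]mx11_scalar mxE lshift0.
have vL (v : 'rV[k]_(1 + m)) : v *m col_mx e L = v 0 0 *: e + rsubmx v *m L.
  by rewrite {1}[v]vE mul_row_col mul_scalar_mx.
split=> // [|v|v].
- by apply: etrans (mul_col_mx e L C) _; rewrite eC LC; exact: vsubmxK.
- rewrite vL bfDr bfZr bZ; have /matrixP/(_ 0 0) := bfE A Z e; rewrite Ze.
  rewrite [(_%:M : 'M__) _ _]mxE mulr1n => <-; rewrite [in RHS](vE v) (@mul_row_scal _ m).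
  by rewrite [RHS]mxE [X in _ = X + _]mxE.
rewrite vL qfD qfZ qe qL bfZl bfC; have /matrixP/(_ 0 0) := bfE A (rsubmx (v : 'rV_(1 + m)) *m L) e.
rewrite -mulmxA Le [(_%:M : 'M__) _ _]mxE mulr1n => <-.
by rewrite [in RHS](vE v) (@qf_row_scal _ m) addrAC.
Qed.

(** * Pfister forms *)

(** This is 2^m, written by doubling so that dimensions match block matrices definitionally. *)
Fixpoint pfdim m := if m is m'.+1 then (pfdim m' + pfdim m')%N else 1%N.

Section PfisterMatrix.
Variable R : comNzRingType.
Implicit Types (b : nat -> R) (a : R).

(** An (m+1)-fold form. The slots come from a sequence on [nat], so the recursion does not change
    their type. *)
Fixpoint pfm m b a : 'M[R]_(pfdim m.+1) :=
  if m is m'.+1 then block_mx (pfm m' b a) 0 0 (b m' *: pfm m' b a)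
  else block_mx 1%:M 1%:M 0 a%:M.

(** The vector of value 1 in the innermost plane [[1, a]], called e0 in the overview; [pfw] is its
    partner y0, of value [a]. *)
Fixpoint pf1 m : 'rV[R]_(pfdim m.+1) :=
  if m is m'.+1 then row_mx (pf1 m') 0 else row_mx 1%:M 0.

Fixpoint pfw m : 'rV[R]_(pfdim m.+1) :=
  if m is m'.+1 then row_mx (pfw m') 0 else row_mx 0 1%:M.

Fixpoint resdim m := if m is m'.+1 then (resdim m' + pfdim m)%N else 0%N.

(** The rows are the basis vectors outside the innermost plane; there are 2^(m+1) - 2 of them. *)
Fixpoint pfres m : 'M[R]_(resdim m, pfdim m.+1) :=
  if m is m'.+1 then block_mx (pfres m') 0 0 1%:M else 0.

Lemma row_split m (v : 'rV[R]_(pfdim m.+2)) :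
  exists x y : 'rV[R]_(pfdim m.+1), v = row_mx x y.
Proof. by exists (lsubmx v), (rsubmx v); rewrite (hsubmxK (v : 'rV_(_ + _))). Qed.

Lemma row_split0 (v : 'rV[R]_(pfdim 1)) : exists x y, v = row_mx x%:M y%:M.
Proof.
exists (lsubmx (v : 'rV_(1 + 1)) 0 0), (rsubmx (v : 'rV_(1 + 1)) 0 0).
by rewrite -!mx11_scalar (hsubmxK (v : 'rV_(1 + 1))).
Qed.

Lemma qf_pfm0 b a x y :
  qf (pfm 0 b a) (row_mx x%:M y%:M) = x ^+ 2 + x * y + a * y ^+ 2.
Proof.
rewrite /qf /= mul_row_block tr_row_mx mul_row_col !tr_scalar_mx.
by rewrite mulmx0 addr0 -!scalar_mxM -!raddfD /= -!scalar_mxM -raddfD /= mxE mulr1n; ring.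
Qed.

Lemma qf_pfmS m b a x y : qf (pfm m.+1 b a) (row_mx x y) =
  qf (pfm m b a) x + b m * qf (pfm m b a) y.
Proof. by rewrite (qf_block (pfm m b a)) qf_scale. Qed.

Lemma bf_pfm0 b a x y z t :
  bf (pfm 0 b a) (row_mx x%:M y%:M) (row_mx z%:M t%:M) =
  (x * z) *+ 2 + x * t + y * z + (a * y * t) *+ 2.
Proof.
rewrite /bf /= tr_block_mx add_block_mx mul_row_block tr_row_mx mul_row_col !tr_scalar_mx.
rewrite trmx0 addr0 add0r -!raddfD /= -!scalar_mxM -!raddfD /= -!scalar_mxM -raddfD /= mxE.
by rewrite mulr1n; ring.
Qed.

Lemma bf_pfmS m b a x y z t : bf (pfm m.+1 b a) (row_mx x y) (row_mx z t) =
  bf (pfm m b a) x z + b m * bf (pfm m b a) y t.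
Proof. by rewrite (bf_block (pfm m b a)) bf_scale. Qed.

Lemma qf_pf1 m b a : qf (pfm m b a) (pf1 m) = 1.
Proof.
elim: m => [|m IHm]; last by rewrite qf_pfmS IHm qf0 mulr0 addr0.
by rewrite /pf1 -(raddf0 (@scalar_mx R 1)) qf_pfm0; ring.
Qed.

Lemma qf_pfw m b a : qf (pfm m b a) (pfw m) = a.
Proof.
elim: m => [|m IHm]; last by rewrite qf_pfmS IHm qf0 mulr0 addr0.
by rewrite /pfw -(raddf0 (@scalar_mx R 1)) qf_pfm0; ring.
Qed.

Lemma bf_pf1w m b a : bf (pfm m b a) (pf1 m) (pfw m) = 1.
Proof.
elim: m => [|m IHm]; last by rewrite bf_pfmS IHm bf0l mulr0 addr0.
by rewrite /pfw /pf1 -(raddf0 (@scalar_mx R 1)) bf_pfm0; ring.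
Qed.

Lemma mul_pfresS m u v : (row_mx u v : 'rV_(resdim m.+1)) *m pfres m.+1 =
  row_mx (u *m pfres m) v.
Proof. by rewrite /= mul_row_block !mulmx0 mulmx1 addr0 add0r. Qed.

Lemma res_split m (v : 'rV[R]_(resdim m.+1)) : exists x y, v = row_mx x y.
Proof. by exists (lsubmx v), (rsubmx v); rewrite (hsubmxK (v : 'rV_(_ + _))). Qed.

Lemma bf_pf1res m b a v : bf (pfm m b a) (pf1 m) (v *m pfres m) = 0.
Proof.
elim: m v => [|m IHm] v; first by rewrite mulmx0 bf0r.
by have [x [y ->]] := res_split v; rewrite mul_pfresS bf_pfmS IHm bf0l mulr0 addr0.
Qed.

Lemma bf_pfwres m b a v : bf (pfm m b a) (pfw m) (v *m pfres m) = 0.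
Proof.
elim: m v => [|m IHm] v; first by rewrite mulmx0 bf0r.
by have [x [y ->]] := res_split v; rewrite mul_pfresS bf_pfmS IHm bf0l mulr0 addr0.
Qed.

Lemma pf_decomp m (v : 'rV[R]_(pfdim m.+1)) :
  exists x y w, v = x *: pf1 m + y *: pfw m + w *m pfres m.
Proof.
elim: m v => [|m IHm] v.
  have [x [y ->]] := row_split0 v; exists x, y, 0; rewrite mulmx0 addr0 /=.
  by rewrite !scale_row_mx add_row_mx !scaler0 add0r addr0 !scale_scalar_mx !mulr1.
have [v1 [v2 ->]] := row_split v; have [x [y [w ->]]] := IHm v1.
exists x, y, (row_mx w v2); rewrite mul_pfresS /= !scale_row_mx !add_row_mx.
by rewrite !scaler0 !add0r.
Qed.

End PfisterMatrix.

Lemma map_pfm (R S : comNzRingType) (f : {rmorphism R -> S}) m b a :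
  map_mx f (pfm m b a) = pfm m (f \o b) (f a).
Proof.
elim: m => [|m IHm] /=.
  by rewrite map_block_mx !map_scalar_mx map_mx0 rmorph1.
by rewrite map_block_mx !map_mx0 map_mxZ IHm.
Qed.

Lemma map_pf1 (R S : comNzRingType) (f : {rmorphism R -> S}) m :
  map_mx f (pf1 R m) = pf1 S m.
Proof. by elim: m => [|m IHm] /=; rewrite map_row_mx map_mx0 ?map_mx1 ?IHm. Qed.

Lemma map_pfres (R S : comNzRingType) (f : {rmorphism R -> S}) m :
  map_mx f (pfres R m) = pfres S m.
Proof.
by elim: m => [|m IHm] /=; rewrite ?map_block_mx !map_mx0 // map_mx1 IHm.
Qed.

Section PfisterField.
Variables (k : fieldType).
Implicit Types (b : nat -> k) (a : k).

Lemma pfm_nondeg (ch2 : 2%N \in [pchar k]) m b a x :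
  (forall i, b i != 0) -> (forall y, bf (pfm m b a) x y = 0) -> x = 0.
Proof.
move=> b0; elim: m x => [|m IHm] x.
  have [u [v ->]] := row_split0 x => bx.
  have := bx (row_mx 1%:M 0%:M); have := bx (row_mx 0%:M 1%:M).
  rewrite !bf_pfm0 !mulrn_pchar // !mulr0 !mulr1 !addr0 !add0r => -> ->.
  by rewrite raddf0 row_mx0.
have [u [v ->]] := row_split x => bx.
have -> : u = 0.
  by apply: IHm => y; have := bx (row_mx y 0); rewrite bf_pfmS bf0r mulr0 addr0.
suff -> : v = 0 by exact: row_mx0.
apply: IHm => y; have := bx (row_mx 0 y); rewrite bf_pfmS bf0r add0r => /eqP.
by rewrite mulf_eq0 (negbTE (b0 m)) => /eqP.
Qed.

Lemma similitude_unit N (A S : 'M[k]_N) c :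
  aniso A -> c != 0 -> (forall v, qf A (v *m S) = c * qf A v) -> S \in unitmx.
Proof.
move=> anA c0 qS; rewrite -row_free_unit -kermx_eq0; apply/eqP/row_matrixP=> i.
rewrite row0; apply: anA; apply: (mulfI c0).
by rewrite -qS -row_mul mulmx_ker row0 qf0 mulr0.
Qed.

Lemma similitude_bf N (A S : 'M[k]_N) c u v :
  (forall v, qf A (v *m S) = c * qf A v) -> bf A (u *m S) (v *m S) = c * bf A u v.
Proof.
move=> qS; rewrite bf_mul -bf_scale; apply: qeq_bf; apply/qeqP=> x.
by rewrite -qf_mul qS qf_scale.
Qed.

(* The matrix of right multiplication by y in the algebras of the
   Cayley-Dickson process; D' plays the role of the conjugate of B, in a form
   that needs no multiplicative structure. *)
Lemma pfm_round m b a y : aniso (pfm m b a) -> y != 0 ->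
  exists2 S, forall v, qf (pfm m b a) (v *m S) = qf (pfm m b a) y * qf (pfm m b a) v
           & pf1 k m *m S = y.
Proof.
elim: m y => [|m IHm] y anA y0.
  have [p [r ->]] := row_split0 y.
  (* Multiplication by p + r w in the quadratic algebra with w^2 = w - a, whose norm form is
     [[1, a]]. *)
  exists (block_mx p%:M r%:M (- (r * a))%:M (p + r)%:M : 'M_(1 + 1)) => [v|].
    have [x [z ->]] := row_split0 v.
    rewrite mul_row_block -!scalar_mxM -!raddfD !qf_pfm0; ring.
  by rewrite /= mul_row_block !mul1mx !mul0mx !addr0.
have an1 : aniso (pfm m b a).
  move=> x qx; have := anA (row_mx x 0); rewrite qf_pfmS qf0 mulr0 addr0 => /(_ qx).
  by rewrite -[RHS](row_mx0 _ _ (pfdim m.+1)) => /eq_row_mx[].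
have [x1 [x2 yE]] := row_split y; rewrite {}yE in y0 *.
(* If [x1 = 0] there is no invertible [S]; the map sending (u, w) to (b w B, u B) serves instead. *)
have [z1|nz1] := eqVneq x1 0.
  have nz2 : x2 != 0 by apply: contra y0 => /eqP ->; rewrite z1 row_mx0.
  have [B qB B1] := IHm x2 an1 nz2.
  exists (block_mx 0 B (b m *: B) 0 : 'M_(pfdim m.+1 + pfdim m.+1)) => [v|].
    have [u [w ->]] := row_split v.
    rewrite mul_row_block !mulmx0 add0r addr0 -scalemxAr !qf_pfmS qfZ !qB z1 qf0; ring.
  by rewrite [pf1 _ _]/= mul_row_block !mulmx0 !mul0mx !addr0 B1 z1.
have [S qS S1] := IHm x1 an1 nz1.
set q := qf (pfm m b a) in qS *.
have q1 : q x1 != 0 by apply: contra nz1 => /eqP/an1/eqP.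
have Su := similitude_unit an1 q1 qS.
(* The similitude will send (u, w) to (u S - b w D', u B + w S). The last clause, satisfied by (q x2
   / q x1) S B^-1 S, makes the two cross terms of its value cancel. *)
have [B [D' [qB B1 qD' BD]]] : exists B D', [/\ forall v, q (v *m B) = q x2 * q v,
    pf1 k m *m B = x2, forall v, q (v *m D') = q x2 * q v &
    forall u w, bf (pfm m b a) (u *m S) (w *m D') = bf (pfm m b a) (u *m B) (w *m S)].
  have [z2|nz2] := eqVneq x2 0.
    exists 0, 0; rewrite z2 /q; split=> [v||v|u w];
    by rewrite ?mulmx0 ?qf0 ?mul0r ?bf0l ?bf0r.
  have [B qB B1] := IHm x2 an1 nz2; rewrite -/q in qB.
  have q2 : q x2 != 0 by apply: contra nz2 => /eqP/an1/eqP.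
  have Bu := similitude_unit an1 q2 qB.
  have qBV v : q (v *m invmx B) = q v / q x2.
    by rewrite -{2}(mulmxKV Bu v) qB mulrC mulKf.
  exists B, ((q x2 / q x1) *: (S *m invmx B *m S)).
  split=> // [v|u w]; rewrite -scalemxAr !mulmxA.
    by rewrite /q qfZ -/q qS qBV qS; field; rewrite ?q1 ?q2.
  rewrite bfZr (similitude_bf _ _ qS).
  by rewrite -[in RHS](mulmxKV Bu (w *m S)) (similitude_bf _ _ qB); field.
exists (block_mx S B (- b m *: D') S : 'M_(pfdim m.+1 + pfdim m.+1)) => [v|].
  have [u [w ->]] := row_split v.
  rewrite mul_row_block !qf_pfmS -scalemxAr !qfD qfZ bfZr -/q !qS !qB qD' BD; ring.
by rewrite [pf1 _ _]/= mul_row_block !mul0mx !addr0 S1 B1.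
Qed.

(** If the form with one slot fewer is anisotropic, roundness spreads a zero (x1, x2) to all (v S, v
    B), where the value is (q x1 + b q x2) q v = 0. Otherwise two copies of the smaller totally
    isotropic space do. *)
Lemma pfm_isotropic_half m b a x : (forall i, b i != 0) ->
  x != 0 -> qf (pfm m b a) x = 0 ->
  exists2 T : 'M_(pfdim m, pfdim m.+1), row_free T & forall v, qf (pfm m b a) (v *m T) = 0.
Proof.
move=> b0; elim: m x => [|m IHm] x x0 qx.
  exists x => [|v]; first by rewrite /row_free rank_rV x0.
  by rewrite [v]mx11_scalar mul_scalar_mx qfZ qx mulr0.
have [an1|/existsNP[z /not_implyP[qz /eqP z0]]] := pselect (aniso (pfm m b a)); last first.
  have [T Tf qT] := IHm z z0 qz.
  exists (block_mx T 0 0 T : 'M_(pfdim m + pfdim m, pfdim m.+1 + pfdim m.+1)) => [|v].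
    by rewrite /row_free rank_diag_block_mx !(eqP Tf).
  rewrite -(hsubmxK (v : 'rV_(_ + _))) mul_row_block !mulmx0 addr0 add0r qf_pfmS !qT.
  by rewrite mulr0 addr0.
have [x1 [x2 xE]] := row_split x; rewrite {}xE qf_pfmS in x0 qx.
have nz1 : x1 != 0.
  apply: contra x0 => /eqP z1; move: qx; rewrite z1 qf0 add0r => /eqP.
  by rewrite mulf_eq0 (negbTE (b0 m)) => /eqP/an1 ->; rewrite row_mx0.
have nz2 : x2 != 0.
  by apply: contra nz1 => /eqP z2; apply/eqP/an1; move: qx; rewrite z2 qf0 mulr0 addr0.
have [S qS _] := pfm_round an1 nz1; have [B qB _] := pfm_round an1 nz2.
exists (row_mx S B) => [|v]; last first.
  by rewrite mul_mx_row qf_pfmS qS qB mulrA -mulrDl qx mul0r.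
have q1 : qf (pfm m b a) x1 != 0 by apply: contra nz1 => /eqP/an1/eqP.
apply/row_freeP; exists (col_mx (invmx S) 0).
by rewrite mul_row_col mulmx0 addr0 mulmxV // (similitude_unit an1 q1 qS).
Qed.

(** A totally isotropic space of dimension 2^m, at least 2, meets the hyperplane orthogonal to
    [pf1]. *)
Lemma pfm_isotropic_pure m b a x : (forall i, b i != 0) -> (0 < m)%N ->
  x != 0 -> qf (pfm m b a) x = 0 ->
  exists z, [/\ z != 0, qf (pfm m b a) z = 0 & bf (pfm m b a) (pf1 k m) z = 0].
Proof.
move=> b0 m0 x0 qx; have [T Tf qT] := pfm_isotropic_half b0 x0 qx.
pose M := T *m ((pfm m b a + (pfm m b a)^T) *m (pf1 k m)^T).
have /rowV0Pn[v /sub_kermxP vM v0] : kermx M != 0.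
  rewrite -mxrank_eq0 mxrank_ker -lt0n subn_gt0.
  apply: (leq_ltn_trans (rank_leq_col M)); case: m m0 {M T Tf qT x x0 qx} => // m _.
  have pfdim_gt0 i : (0 < pfdim i)%N by elim: i => //= i; lia.
  by have := pfdim_gt0 m; rewrite /=; lia.
exists (v *m T); split; rewrite ?qT //.
  by apply: contra v0 => /eqP vT0; apply/eqP/(row_free_inj Tf); rewrite vT0 mul0mx.
by move: vM; rewrite bfC /M mulmxA bfE => /matrixP/(_ 0 0); rewrite !mxE mulr1n.
Qed.
End PfisterField.

(** * Constructions of fields *)

Section Subfield.
Variables (M : fieldType) (S : M -> Prop).
Hypotheses (S1 : S 1) (SB : forall x y, S x -> S y -> S (x - y))
  (SD : forall x y, S x -> S y -> S (x / y)).

Definition subfield_pred : pred M := fun x => `[< S x >].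

Fact subfield_closed : divring_closed subfield_pred.
Proof.
split=> [|x y Sx Sy|x y Sx Sy]; apply: asboolT => //.
  by apply: SB; exact: asboolW.
by apply: SD; exact: asboolW.
Qed.

HB.instance Definition _ := GRing.isDivringClosed.Build M subfield_pred subfield_closed.

Definition subfield := {x : M | subfield_pred x}.
HB.instance Definition _ := SubType.on subfield.
HB.instance Definition _ := [Choice of subfield by <:].
HB.instance Definition _ := [SubChoice_isSubIntegralDomain of subfield by <:].
HB.instance Definition _ := [SubIntegralDomain_isSubField of subfield by <:].

Lemma subfield_exists : exists (E : fieldType) (r : {rmorphism E -> M}),
  forall y, S y <-> exists x, r x = y.
Proof.
exists subfield, val => y; split=> [Sy|[x <-]].
  have Py : subfield_pred y by exact/asboolP.
  by exists (exist _ y Py).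
by apply/asboolP; exact: (valP x).
Qed.
End Subfield.

Lemma rmorphism_exists (R S : nzRingType) (g : R -> S) :
  g 1 = 1 -> {morph g : x y / x - y} -> {morph g : x y / x * y} ->
  exists h : {rmorphism R -> S}, forall x, h x = g x.
Proof.
move=> g1 gB gM; pose zm := GRing.isZmodMorphism.Build R S g gB.
pose mm := GRing.isMonoidMorphism.Build R S g (conj g1 gM).
pose h : {rmorphism R -> S} := HB.pack g zm mm.
by exists h.
Qed.

Lemma rmorphism_lift (k E M : fieldType) (r : {rmorphism E -> M}) (g : {rmorphism k -> M}) :
  (forall x, exists y, r y = g x) ->
  exists h : {rmorphism k -> E}, forall x, r (h x) = g x.
Proof.
move=> /choice[h hE]; have rI := fmorph_inj r.
have [] := @rmorphism_exists k E h.
- by apply: rI; rewrite hE !rmorph1.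
- by move=> x y; apply: rI; rewrite rmorphB !hE rmorphB.
- by move=> x y; apply: rI; rewrite rmorphM !hE rmorphM.
by move=> h' h'E; exists h' => x; rewrite h'E.
Qed.

Lemma subf_div (F : fieldType) (a b c d : F) :
  b != 0 -> d != 0 -> a / b - c / d = (a * d - c * b) / (b * d).
Proof. by move=> b0 d0; rewrite -mulNr addf_div // mulNr. Qed.

Lemma frac_extend (R : idomainType) (L : fieldType) (g : {rmorphism R -> L}) :
  injective g -> exists h : {rmorphism {fraction R} -> L}, forall x, h (tofr x) = g x.
Proof.
move=> gI; have g0 d : d != 0 -> g d != 0.
  by apply: contra => /eqP gd0; apply/eqP/gI; rewrite rmorph0.
have /choice[n /choice[d nd]] := @fractionP R.
pose h x := g (n x) / g (d x).
have hE (u v : R) : v != 0 -> h (tofr u / tofr v) = g u / g v.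
  move=> v0; rewrite /h; have [d0 E] := nd (tofr u / tofr v).
  apply/eqP; rewrite eqr_div ?g0 // -!rmorphM; apply/eqP; congr (g _).
  by apply/eqP; move/eqP: E; rewrite eqr_div ?tofrac_eq0 // -!rmorphM tofrac_eq /= eq_sym.
have hT u : h (tofr u) = g u.
  by have := hE u 1 (oner_neq0 _); rewrite !rmorph1 !divr1.
have [] := @rmorphism_exists {fraction R} L h.
- by have := hT 1; rewrite !rmorph1.
- move=> x y; have [dx Ex] := nd x; have [dy Ey] := nd y.
  have -> : x - y = tofr (n x * d y - n y * d x) / tofr (d x * d y).
    by rewrite [LHS](congr2 _ Ex (congr1 _ Ey)) subf_div ?tofrac_eq0 // rmorphB !rmorphM.
  by rewrite hE ?mulf_neq0 // rmorphB !rmorphM /h subf_div ?g0.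
- move=> x y; have [dx Ex] := nd x; have [dy Ey] := nd y.
  have -> : x * y = tofr (n x * n y) / tofr (d x * d y).
    by rewrite [LHS](congr2 _ Ex Ey) mulf_div !rmorphM.
  by rewrite hE ?mulf_neq0 // !rmorphM /h mulf_div.
by move=> h' h'E; exists h' => x; rewrite h'E hT.
Qed.

Lemma ratfun_map (k K : fieldType) (f : {rmorphism k -> K}) m :
  exists h : {rmorphism ratfun k m -> ratfun K m},
    (forall x, h (ratC k m x) = ratC K m (f x)) /\ map_mx h (genpt k m) = genpt K m.
Proof.
elim: m => [|m [h [hC hg]]]; first by exists f; split=> //; rewrite /= map_mx0.
pose g : {rmorphism {poly ratfun k m} -> {fraction {poly ratfun K m}}} :=
  tofr \o map_poly h.
have [|h' h'E] := frac_extend (g := g).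
  move=> p q /eqP; rewrite /g /= tofrac_eq => /eqP; exact: map_poly_inj.
exists h'; split=> [x|].
  apply: etrans (h'E _) _; rewrite /g /= map_polyC /= hC //.
apply: etrans (map_row_mx h' (ratX k m)%:M (map_mx (ratS k m) (genpt k m))) _.
rewrite /= -hg map_scalar_mx; congr (row_mx _%:M _).
  by apply: etrans (h'E _) _; rewrite /g /= map_polyX.
apply/rowP=> i; rewrite !mxE.
by apply: etrans (h'E _) _; rewrite /g /= map_polyC.
Qed.

(** Generating the quadratic field inside a given [M] supplies the embedding along which anisotropy
    and non-isometry later descend. Inverses come from conjugates. *)
Lemma quad_subfield (k M : fieldType) (ch2 : 2%N \in [pchar k])
    (j : {rmorphism k -> M}) (e c : k) u :
  u ^+ 2 + j e * u + j c = 0 ->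
  exists (E : fieldType) (i : {rmorphism k -> E}) (r : {rmorphism E -> M}) v,
    [/\ forall x, r (i x) = j x, r v = u & forall z, exists x y, z = i x + i y * v].
Proof.
move=> u2; have ch2M := rmorph_pchar j ch2.
have u2E : u ^+ 2 = j e * u + j c.
  by apply/eqP; rewrite -subr_eq0 oppr_pchar2 // addrA u2.
pose S z := exists x y, z = j x + j y * u.
have Sj x : S (j x) by exists x, 0; rewrite rmorph0 mul0r addr0.
have Su : S u by exists 0, 1; rewrite rmorph0 rmorph1 add0r mul1r.
have SM x y : S x -> S y -> S (x * y).
  move=> [a [b ->]] [a' [b' ->]]; exists (a * a' + b * b' * c), (a * b' + b * a' + b * b' * e).
  rewrite !(rmorphD, rmorphM).
  by transitivity
    (j a * j a' + (j a * j b' + j b * j a') * u + j b * j b' * u ^+ 2); [|rewrite u2E]; ring.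
have SV x : S x -> S x^-1.
  move=> [a [b ->]]; pose N := a ^+ 2 + a * b * e + b ^+ 2 * c.
  have NE : (j a + j b * u) * (j a + j b * j e + j b * u) = j N.
    rewrite /N !(rmorphD, rmorphM, rmorphXn) /=.
    transitivity (j a ^+ 2 + j a * j b * j e + j b ^+ 2 * (u ^+ 2 - j e * u)
        + (j a * j b * u + j b ^+ 2 * (j e * u)) *+ 2); first by ring.
    by rewrite mulrn_pchar // u2E; ring.
  have SC : S (j a + j b * j e + j b * u).
    by exists (a + b * e), b; rewrite rmorphD rmorphM.

  (* If the norm vanishes, the element is 0 or its conjugate is, and in the latter case the element
     is [j (b * e)]. *)
  have [N0|N0] := eqVneq N 0; last first.
    have jN : j N != 0 by rewrite fmorph_eq0.
    have nz : j a + j b * j e + j b * u != 0.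
      by apply: contraNneq jN => z0; rewrite -NE z0 mulr0.
    have -> : (j a + j b * u)^-1 = j N^-1 * (j a + j b * j e + j b * u).
      by rewrite fmorphV -NE invfM -mulrA mulVf ?mulr1.
    exact: SM.
  move/eqP: NE; rewrite N0 rmorph0 mulf_eq0 => /orP[/eqP ->|z0].
    by rewrite invr0 -(rmorph0 j); exact: Sj.
  have -> : j a + j b * u = j (b * e).
    rewrite rmorphM; apply/eqP; rewrite -subr_eq0 oppr_pchar2 //.
    by rewrite addrAC.
  by rewrite -fmorphV; exact: Sj.
have [|x y|x y|E [r rE]] := @subfield_exists M S.
- by rewrite -(rmorph1 j); exact: Sj.
- move=> [a [b ->]] [a' [b' ->]]; exists (a - a'), (b - b').
  by rewrite !rmorphB; ring.
- by move=> Sx Sy; apply: SM Sx (SV _ Sy).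
have [i iE] := rmorphism_lift (r := r) (g := j) (fun x => (rE (j x)).1 (Sj x)).
have [v vE] := (rE u).1 Su; exists E, i, r, v; split=> // z.
have [x [y zE]] := (rE (r z)).2 (ex_intro _ z erefl).
exists x, y; apply: (fmorph_inj r).
by rewrite zE rmorphD rmorphM !iE vE.
Qed.

Lemma quad_root (k : fieldType) (e c : k) :
  exists (M : fieldType) (j : {rmorphism k -> M}) u, u ^+ 2 + j e * u + j c = 0.
Proof.
have [[x x2]|nr] := pselect (exists x, x ^+ 2 + e * x + c = 0).
  by exists k, idfun, x.
pose p : {poly k} := 'X^2 + (e%:P * 'X + c%:P).
have pE x : p.[x] = x ^+ 2 + e * x + c.
  by rewrite /p !(hornerD, hornerM, hornerXn, hornerC, hornerX) addrA.
have sp : size p = 3%N.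
  rewrite size_polyDl ?size_polyXn // (leq_ltn_trans (size_polyD _ _)) //.
  rewrite gtn_max mulrC (leq_ltn_trans (size_polyMC_leq _ _)) ?size_polyX //=.
  by rewrite (leq_ltn_trans (size_polyC_leq1 _)).
have [|M _ [u uP _]] := irredp_FAdjoin (p := p).
  apply: cubic_irreducible; rewrite ?sp // => x.
  by apply/negP=> /rootP px; apply: nr; exists x; rewrite -pE.
exists M, (in_alg M), u; move/rootP: uP.
rewrite /p !(rmorphD, rmorphXn, rmorphM) /= !map_polyX !map_polyC /=.
by rewrite !(hornerD, hornerM, horner_exp, hornerC, hornerX) addrA.
Qed.

Lemma quad_field (k : fieldType) (ch2 : 2%N \in [pchar k]) (e c : k) :
  exists (E : fieldType) (i : {rmorphism k -> E}) v,
    v ^+ 2 + i e * v + i c = 0 /\ forall z, exists x y, z = i x + i y * v.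
Proof.
have [M [j [u uE]]] := quad_root e c.
have [E [i [r [v [ri rv iv]]]]] := quad_subfield ch2 uE.
exists E, i, v; split=> //; apply: (fmorph_inj r).
by rewrite !rmorphD rmorphXn rmorphM !ri rv uE rmorph0.
Qed.

(** * Function fields of affine quadrics *)

Lemma anisoP (k : fieldType) N (A : 'M[k]_N) :
  (forall x, x != 0 -> qf A x = 0 -> False) -> aniso A.
Proof. by move=> anA x qx; apply/eqP; apply: contraT => x0; case: (anA x x0 qx). Qed.

Lemma aniso_inj (k K : fieldType) (f : {rmorphism k -> K}) N (A : 'M[k]_N) :
  aniso (map_mx f A) -> aniso A.
Proof.
move=> anA x qx; have := anA (map_mx f x); rewrite qf_map qx rmorph0 => /(_ erefl)/eqP.
by rewrite map_mx_eq0 => /eqP.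
Qed.

Lemma map_iso (k K : fieldType) (f : {rmorphism k -> K}) N (A B : 'M[k]_N) :
  iso A B -> iso (map_mx f A) (map_mx f B).
Proof.
move=> [P [E D]]; exists (map_mx f P); rewrite map_trmx -!map_mxM.
split=> [|i]; last by rewrite !map_mxE D.
by rewrite !map_trmx -!map_mxD E.
Qed.

(** The two coordinates of a zero X + v Y satisfy q X = g q Y and b(X, Y) = e q Y. Undoing the
    similitude that takes [pf1] to [Y] divides both relations by q Y. *)
Lemma quad_ext_isotropic (K : fieldType) (ch2 : 2%N \in [pchar K]) n (b : nat -> K) a
    (E : fieldType) (i : {rmorphism K -> E}) (e g : K) v z :
  aniso (pfm n b a) -> v ^+ 2 + i e * v + i g = 0 ->
  (forall z, exists x y, z = i x + i y * v) ->
  z != 0 -> qf (map_mx i (pfm n b a)) z = 0 ->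
  exists2 X, qf (pfm n b a) X = g & bf (pfm n b a) (pf1 K n) X = e.
Proof.
move=> anA v2 iv z0 qz; have ch2E := rmorph_pchar i ch2.
set A := pfm n b a in anA qz *.
have v2E : v ^+ 2 = i e * v + i g.
  by apply/eqP; rewrite -subr_eq0 oppr_pchar2 // addrA v2.
have /fin_all_exists [x /fin_all_exists[y zE]] j := iv (z 0 j).
pose X := \row_j x j; pose Y := \row_j y j.
have {}zE : z = map_mx i X + v *: map_mx i Y.
  by apply/rowP=> j; rewrite !mxE zE; congr (_ + _); exact: mulrC.
(* Were [v] in [K], the zero would be defined over [K]. Hence coefficients of 1 and [v] may be
   compared. *)
have nov w : v <> i w.
  move=> vw; have [X' zX] : exists X', z = map_mx i X'.
    by exists (X + w *: Y); rewrite zE vw map_mxD map_mxZ.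
  move: qz z0; rewrite zX qf_map => /eqP.
  by rewrite fmorph_eq0 map_mx_eq0 => /eqP/anA ->; rewrite eqxx.
have qE : i (qf A X + g * qf A Y) + i (bf A X Y + e * qf A Y) * v = 0.
  rewrite -qz zE qfD qfZ bfZr !qf_map bf_map v2E !(rmorphD, rmorphM); ring.
have Q0 : bf A X Y + e * qf A Y = 0.
  apply/eqP; apply: contraT => nz.
  case: (nov (- (qf A X + g * qf A Y) / (bf A X Y + e * qf A Y))).
  rewrite fmorph_div rmorphN; apply: (canRL (mulfK _)); first by rewrite fmorph_eq0.
  by apply/eqP; rewrite -addr_eq0 mulrC addrC qE.
have P0 : qf A X + g * qf A Y = 0.
  by apply/eqP; rewrite -(fmorph_eq0 i); move/eqP: qE; rewrite Q0 rmorph0 mul0r addr0.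
have Y0 : Y != 0.
  apply: contra z0 => /eqP Y0; move: P0; rewrite Y0 qf0 mulr0 addr0 => /anA X0.
  by rewrite zE X0 Y0 map_mx0 scaler0 addr0.
have [S qS S1] := pfm_round anA Y0; rewrite -/A in qS.
have qY0 : qf A Y != 0 by apply: contra Y0 => /eqP/anA/eqP.
have Su := similitude_unit anA qY0 qS.
have E2 (s t : K) : s + t = 0 -> s = t.
  by move=> /eqP; rewrite addr_eq0 oppr_pchar2 // => /eqP.
exists (X *m invmx S); apply: (mulfI qY0).
  by rewrite -qS mulmxKV // mulrC; apply: E2.
by rewrite -(similitude_bf _ _ qS) mulmxKV // S1 bfC mulrC; apply: E2.
Qed.

(** Roundness over the rational function field yields one vector; [subform], with pairing against
    [pf1] as the linear condition, brings it down to [k]. *)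
Lemma generic_quad_isotropic (k : fieldType) (ch2 : 2%N \in [pchar k]) n b a m
    (B : 'M[k]_m) (e c : k) (E : fieldType) (i : {rmorphism ratfun k m -> E}) v z :
  let A := pfm n b a in
  aniso A ->
  v ^+ 2 + i (ratC k m e) * v +
    i (ratC k m c + qf (map_mx (ratC k m) B) (genpt k m)) = 0 ->
  (forall z, exists x y, z = i x + i y * v) ->
  z != 0 -> qf (map_mx i (map_mx (ratC k m) A)) z = 0 ->
  exists Y L, [/\ qf A Y = c, bf A (pf1 k n) Y = e,
    forall v, bf A (pf1 k n) (v *m L) = 0, forall v, bf A Y (v *m L) = 0 &
    forall v, qf A (v *m L) = qf B v].
Proof.
move=> A anA vE iv z0 qz; have anK := aniso_ratfun (m := m) anA.
rewrite /A map_pfm in qz anK.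
have [X qX eX] := quad_ext_isotropic (rmorph_pchar (ratC k m) ch2) anK vE iv z0 qz.
rewrite -map_pfm -/A in qX eX.
have [||Y [L [qY eY eL bY qL]]] :=
  @subform k ch2 _ A m anA 1 ((A + A^T) *m (pf1 k n)^T) c 0 B e%:M 0 X.
- by rewrite map_mx0 mulmx0 mxE addr0.
- rewrite map_mx0 mulmx0 addr0 map_mxM map_mxD -!map_trmx bfE map_pf1 bfC eX.
  by rewrite map_scalar_mx.
exists Y, L; split=> // [|w|w].
- by move: eY; rewrite bfE bfC => /matrixP/(_ 0 0); rewrite !mxE !mulr1n.
- have EL : w *m L *m ((A + A^T) *m (pf1 k n)^T) = 0 by rewrite -mulmxA eL mulmx0.
  by rewrite bfC /bf -mulmxA EL mxE.
by rewrite bY mulmx0 mxE.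
Qed.

Definition psi (R : comNzRingType) n (b : nat -> R) a :=
  pfres R n *m pfm n b a *m (pfres R n)^T.

Lemma map_psi (R S : comNzRingType) (f : {rmorphism R -> S}) n b a :
  map_mx f (psi n b a) = psi n (f \o b) (f a).
Proof. by rewrite /psi !map_mxM -map_trmx map_pfres map_pfm. Qed.

Lemma qf_pf_decomp (R : comNzRingType) n (b : nat -> R) a x y w :
  qf (pfm n b a) (x *: pf1 R n + y *: pfw R n + w *m pfres R n) =
  x ^+ 2 + x * y + a * y ^+ 2 + qf (psi n b a) w.
Proof.
rewrite !qfD !qfZ bfDl !bfZl bfZr bf_pf1res bf_pfwres qf_pf1 qf_pfw bf_pf1w.
by rewrite qf_mul -/(psi n b a); ring.
Qed.

Lemma bf_pf1_decomp (R : comNzRingType) (ch2 : 2%N \in [pchar R]) n (b : nat -> R) a x y w :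
  bf (pfm n b a) (pf1 R n) (x *: pf1 R n + y *: pfw R n + w *m pfres R n) = y.
Proof.
by rewrite !bfDr !bfZr bf_pf1res bf_pf1w bfxx mulrn_pchar // mulr0 mulr1 addr0 add0r.
Qed.

(* pf1, pfw and the rows of pfres are the standard basis vectors. *)
Lemma pf_linear_ext (R : comNzRingType) n p (y z : 'rV[R]_p) (L : 'M_(resdim n, p)) :
  exists P, [/\ pf1 R n *m P = y, pfw R n *m P = z & pfres R n *m P = L].
Proof.
elim: n => [|n IHn] in p y z L *.
  exists (col_mx y z); rewrite /= !mul_row_col !mul1mx !mul0mx addr0 add0r; split=> //.
  by apply/matrixP=> -[].
have [P [P1 P2 P3]] := IHn p y z (usubmx (L : 'M_(_ + _, p))).
exists (col_mx P (dsubmx (L : 'M_(_ + _, p)))).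
rewrite /= !mul_row_col !mul0mx !addr0 P1 P2; split=> //.
by rewrite mul_block_col !mul0mx mul1mx addr0 add0r P3 (vsubmxK (L : 'M_(_ + _, p))).
Qed.

Lemma psi_nondeg (k : fieldType) (ch2 : 2%N \in [pchar k]) n (b : nat -> k) a w :
  (forall i, b i != 0) -> (forall v, bf (psi n b a) w v = 0) -> w *m pfres k n = 0.
Proof.
move=> b0 w0; apply: (pfm_nondeg ch2 b0 (a := a)) => y.
have [s [t [v ->]]] := pf_decomp y; rewrite !bfDr !bfZr.
by rewrite ![bf _ (w *m _) _]bfC bf_pf1res bf_pfwres bfC bf_mul w0 !mulr0 !addr0.
Qed.

Lemma generic_vector (R E : fieldType) (ch2 : 2%N \in [pchar R])
    (j : {rmorphism R -> E}) n (b : nat -> R) (a e x : R) w v :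
  e ^+ 2 = e -> v ^+ 2 + j e * v + (j x + j e * j a + qf (map_mx j (psi n b a)) w) = 0 ->
  let z := v *: pf1 E n + j e *: pfw E n + w *m pfres E n in
  qf (map_mx j (pfm n b a)) z = j x /\ bf (map_mx j (pfm n b a)) (pf1 E n) z = j e.
Proof.
move=> ee vE z; have ch2E := rmorph_pchar j ch2; rewrite map_pfm /z bf_pf1_decomp //.
split=> //; rewrite qf_pf_decomp -rmorphXn ee -map_psi /=; apply/eqP; rewrite -subr_eq0.
by rewrite oppr_pchar2 // -vE; apply/eqP; ring.
Qed.

(** [K] is the function field of the affine quadric where [pfm n c d] vanishes and the coordinate
    along [pfw] is 1; its generic zero is nonzero since it pairs to 1 with [pf1]. If [pfm n b a]
    became isotropic, [Y] and the rows of [L] would be images of [pfw] and [pfres] under an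
    isometry. *)
Lemma aniso_generic_point (k : fieldType) (ch2 : 2%N \in [pchar k]) n (b : nat -> k) a
    (c : nat -> k) d :
  (forall i, b i != 0) -> aniso (pfm n b a) -> aniso (pfm n c d) ->
  ~ iso (pfm n b a) (pfm n c d) ->
  exists (K : fieldType) (f : {rmorphism k -> K}),
    aniso (map_mx f (pfm n b a)) /\ ~ aniso (map_mx f (pfm n c d)).
Proof.
move=> b0 anA anA' nAA'; pose m := resdim n; set A := pfm n b a in anA nAA' *.
set A' := pfm n c d in anA' nAA' *.
pose g := ratC k m d + qf (map_mx (ratC k m) (psi n c d)) (genpt k m).
have [K [i [v [vE iv]]]] := quad_field (rmorph_pchar (ratC k m) ch2) (ratC k m 1) g.
exists K, (i \o ratC k m); rewrite !(map_mx_comp (ratC k m) i).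
split; last first.
  have := @generic_vector k K ch2 (i \o ratC k m) n c d 1 0 (map_mx i (genpt k m)) v (expr1n _ _).
  rewrite rmorph0 rmorph1 !mul1r add0r !(map_mx_comp (ratC k m) i) => -[|qz bz].
    by move: vE; rewrite /g rmorph1 rmorphD rmorph1 mul1r qf_map.
  move=> /(_ _ qz) z0; move: bz; rewrite z0 bf0r => /eqP.
  by rewrite eq_sym oner_eq0.
apply: anisoP => z z0 qz.
have [Y [L [qY bY b1L bYL qL]]] :=
  generic_quad_isotropic (B := psi n c d) ch2 anA vE iv z0 qz.
apply: nAA'; apply: aniso_iso_sym => //.
have [P [P1 P2 P3]] := pf_linear_ext (pf1 k n) Y L.
exists P; apply/qeqP=> x; rewrite -qf_mul; have [s [t [w ->]]] := pf_decomp x.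
rewrite qf_pf_decomp !mulmxDl -!scalemxAl P1 P2 -mulmxA P3.
rewrite !qfD !qfZ bfDl !bfZl bfZr b1L bYL bY qY qL qf_pf1; ring.
Qed.

Lemma isometry_to_res (k : fieldType) (ch2 : 2%N \in [pchar k]) n (c : nat -> k) d L :
  aniso (pfm n c d) -> (forall v, bf (pfm n c d) (pf1 k n) (v *m L) = 0) ->
  (forall v, qf (pfm n c d) (v *m L) = qf (psi n c d) v) ->
  exists s, [/\ forall x, qf (pfm n c d) (x *m s) = qf (pfm n c d) x,
    pf1 k n *m s = pf1 k n & L *m s = pfres k n].
Proof.
move=> anA b1 qL; apply: witt_extension => // v; first by rewrite qL -qf_mul.
by rewrite b1 bf_pf1res.
Qed.

Lemma resolve_step (k : fieldType) (ch2 : 2%N \in [pchar k]) n (b : nat -> k) a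
    (c : nat -> k) d (x e : k) :
  (0 < n)%N -> (forall i, b i != 0) -> (forall i, c i != 0) ->
  aniso (pfm n b a) -> aniso (pfm n c d) -> ~ iso (pfm n b a) (pfm n c d) ->
  e ^+ 2 = e -> (forall t, t ^+ 2 + e * t <> x) ->
  exists (E : fieldType) (f : {rmorphism k -> E}),
    [/\ aniso (map_mx f (pfm n b a)), aniso (map_mx f (pfm n c d)),
     ~ iso (map_mx f (pfm n b a)) (map_mx f (pfm n c d)) &
     exists y, qf (map_mx f (pfm n c d)) y = f x /\
               bf (map_mx f (pfm n c d)) (pf1 E n) y = f e].
Proof.
move=> n0 b0 c0 anA anA' nAA' ee nox; pose m := resdim n; pose K := ratfun k m.
have [k1 [f1 [anA1 naA1]]] := aniso_generic_point ch2 b0 anA anA' nAA'.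
have ch21 := rmorph_pchar f1 ch2.
pose g := ratC k m (x + e * d) + qf (map_mx (ratC k m) (psi n c d)) (genpt k m).
pose K1 := ratfun k1 m.
have [h [hC hg]] := ratfun_map f1 m.
pose g1 := ratC k1 m (f1 (x + e * d)) +
  qf (map_mx (ratC k1 m) (psi n (f1 \o c) (f1 d))) (genpt k1 m).
have hg1 : h g = g1.
  rewrite rmorphD /= hC -qf_map hg; congr (_ + qf _ _).
  by rewrite -map_psi; apply/matrixP=> i j; rewrite !map_mxE hC.
have [M [i1 [u [uE iu]]]] := quad_field (rmorph_pchar (ratC k1 m) ch21) (ratC k1 m (f1 e)) g1.
(* Otherwise [psi] embeds in the first form over [k1], orthogonally to [pf1]. A zero s1 e0 + w of
   the second form then gives a zero of the anisotropic first one, so its image vanishes;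
   nondegeneracy of [psi] kills the part along [pfres], and then [s1]. *)
have anM : aniso (map_mx i1 (map_mx (ratC k1 m) (map_mx f1 (pfm n b a)))).
  apply: anisoP => z z0 qz; rewrite map_pfm in qz anA1.
  have [Y [L [qY bY b1L bYL qL]]] :=
    generic_quad_isotropic (B := psi n (f1 \o c) (f1 d)) ch21 anA1 uE iu z0 qz.
  apply: naA1; rewrite map_pfm; apply: anisoP => t t0 qt.
  have c10 i : (f1 \o c) i != 0 by rewrite /= fmorph_eq0.
  have [s [s0 qs bs]] := pfm_isotropic_pure c10 n0 t0 qt.
  have [s1 [s2 [w sE]]] := pf_decomp s.
  move: bs; rewrite sE bf_pf1_decomp // => s2E.
  rewrite s2E scale0r addr0 in sE; move: qs; rewrite sE.
  have := qf_pf_decomp (f1 \o c) (f1 d) s1 0 w.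
  rewrite scale0r addr0 expr0n !mulr0 !addr0 => -> qs.
  have wL : s1 *: pf1 k1 n + w *m L = 0.
    by apply: anA1; rewrite qfD qfZ bfZl qf_pf1 b1L mulr0 addr0 mulr1 qL.
  have qeL : qeq (L *m pfm n (f1 \o b) (f1 a) *m L^T) (psi n (f1 \o c) (f1 d)).
    by apply/qeqP=> v; rewrite -qf_mul qL.
  have w0 : w *m pfres k1 n = 0.
    apply: (psi_nondeg ch21 c10) => v.
    apply: etrans (esym (qeq_bf w v qeL)) _; rewrite -bf_mul.
    have <- : bf (pfm n (f1 \o b) (f1 a)) (s1 *: pf1 k1 n + w *m L) (v *m L) =
      bf (pfm n (f1 \o b) (f1 a)) (w *m L) (v *m L).
      by rewrite bfDl bfZl b1L mulr0 add0r.
    by rewrite wL bf0l.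
  have qw : qf (psi n (f1 \o c) (f1 d)) w = 0 by rewrite -qf_mul w0 qf0.
  move: s0; rewrite sE w0 addr0; move: qs; rewrite qw addr0 => /eqP.
  by rewrite expf_eq0 /= => /eqP ->; rewrite scale0r eqxx.
have uE' : u ^+ 2 + (i1 \o h) (ratC k m e) * u + (i1 \o h) g = 0.
  by rewrite /= hC hg1.
(* [E] is generated over [K] inside [M], so what holds over [M] descends to it. *)
have [E [i [r [v [ri rv iv]]]]] := quad_subfield (rmorph_pchar (ratC k m) ch2) uE'.
have vE : v ^+ 2 + i (ratC k m e) * v + i g = 0.
  by apply: (fmorph_inj r); rewrite 2!(rmorphD r) rmorphXn rmorphM !ri rv rmorph0; exact: uE'.
pose f : {rmorphism k -> E} := i \o ratC k m.
have rf p q (B : 'M[k]_(p, q)) :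
    map_mx r (map_mx f B) = map_mx i1 (map_mx (ratC k1 m) (map_mx f1 B)).
  by apply/matrixP=> s t; rewrite !map_mxE -hC -[RHS]ri.
have anE : aniso (map_mx f (pfm n b a)) by apply: (aniso_inj (f := r)); rewrite rf.
exists E, f; split=> //.
- apply: anisoP => z z0 qz; rewrite (map_mx_comp (ratC k m) i) in qz.
  have [Y [L [qY bY b1L bYL qL]]] :=
    generic_quad_isotropic (B := psi n c d) ch2 anA' vE iv z0 qz.
  (* Once [L] is moved to [pfres], the image of [Y] is orthogonal to it and lies in the plane
     [[1, d]]. Its value gives y1^2 + e y1 + e d = x + e d, a forbidden root. *)
  have [s [qs s1 sL]] := isometry_to_res ch2 anA' b1L qL.
  have [y1 [y2 [w YE]]] := pf_decomp (Y *m s).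
  have y2E : y2 = e by rewrite -(bf_pf1_decomp ch2 c d y1 y2 w) -YE -{1}s1 (isometry_bf _ _ qs).
  have w0 : w *m pfres k n = 0.
    apply: (psi_nondeg (a := d) ch2 c0) => t; rewrite -bf_mul.
    have := bYL t; rewrite -(isometry_bf _ _ qs) -mulmxA sL YE !bfDl !bfZl.
    by rewrite bf_pf1res bf_pfwres !mulr0 !add0r.
  have := qs Y; rewrite YE qf_pf_decomp -qf_mul w0 qf0 addr0 qY y2E ee => H.
  apply: (nox y1); have := congr1 (+%R^~ (d * e)) H.
  rewrite /= -[LHS]addrA addrr_pchar2 // addr0 [e * d]mulrC -addrA addrr_pchar2 // addr0.
  by rewrite mulrC.
- move=> /(map_iso r); rewrite !rf => /(iso_aniso anM) anM'; apply: naA1.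
  by apply: (aniso_inj (f := ratC k1 m)); apply: (aniso_inj (f := i1)).
exists (v *: pf1 E n + f e *: pfw E n + map_mx i (genpt k m) *m pfres E n).
apply: generic_vector => //; rewrite (map_mx_comp (ratC k m) i) qf_map -rmorphM -rmorphD.
by rewrite -[RHS]vE /g /f /= [in RHS]rmorphD.
Qed.

(** * Ultraproducts of fields *)

Section Ultraproduct.
Variables (I : Type) (U : set_system I) (UU : UltraFilter U) (E : I -> fieldType).

Let T := {classic (forall i, E i)}.
Let almost (P : I -> Prop) := U (fun i => P i).

Lemma almost_all (P : I -> Prop) : (forall i, P i) -> almost P.
Proof. by move=> allP; apply: filterS filterT => i _. Qed.

Lemma almostI (P Q R : I -> Prop) :
  almost P -> almost Q -> (forall i, P i -> Q i -> R i) -> almost R.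
Proof. by move=> aP aQ PQR; apply: filterS2 aP aQ. Qed.

Definition ultra_eq (x y : T) := `[< almost (fun i => x i = y i) >].

Lemma ultra_eq_equiv : equiv_class_of ultra_eq.
Proof.
split=> [x|x y|y x z].
- by apply/asboolP/almost_all.
- by apply/asboolP/asboolP; apply: filterS => i ->.
- by move=> /asboolP xy /asboolP yz; apply/asboolP; apply: almostI xy yz _ => i ->.
Qed.

Canonical ultra_equiv := EquivRelPack ultra_eq_equiv.

Definition ultraproduct := {eq_quot ultra_eq}%qT.
HB.instance Definition _ := Choice.on ultraproduct.
HB.instance Definition _ : EqQuotient T ultra_eq ultraproduct := EqQuotient.on ultraproduct.

Definition ucls (x : forall i, E i) : ultraproduct := @pi T ultraproduct x.

Definition urep (x : ultraproduct) : forall i, E i := @repr T ultraproduct x.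

Lemma uclsP x y : ucls x = ucls y <-> almost (fun i => x i = y i).
Proof.
split=> [/eqP|xy]; first by rewrite eqmodE => /asboolP.
by apply/eqP; rewrite eqmodE; apply/asboolP.
Qed.

Lemma uclsK (x : ultraproduct) : ucls (urep x) = x.
Proof. exact: reprK. Qed.

Lemma repr_ucls x : almost (fun i => urep (ucls x) i = x i).
Proof. by apply/uclsP; rewrite uclsK. Qed.

Definition uadd (x y : ultraproduct) := ucls (fun i => urep x i + urep y i).
Definition umul (x y : ultraproduct) := ucls (fun i => urep x i * urep y i).
Definition uopp (x : ultraproduct) := ucls (fun i => - urep x i).
Definition uinv (x : ultraproduct) := ucls (fun i => (urep x i)^-1).

Lemma uaddE x y : uadd (ucls x) (ucls y) = ucls (fun i => x i + y i).
Proof. by apply/uclsP; apply: almostI (repr_ucls x) (repr_ucls y) _ => i -> ->. Qed.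
Lemma umulE x y : umul (ucls x) (ucls y) = ucls (fun i => x i * y i).
Proof. by apply/uclsP; apply: almostI (repr_ucls x) (repr_ucls y) _ => i -> ->. Qed.
Lemma uoppE x : uopp (ucls x) = ucls (fun i => - x i).
Proof. by apply/uclsP; apply: almostI (repr_ucls x) (repr_ucls x) _ => i ->. Qed.
Lemma uinvE x : uinv (ucls x) = ucls (fun i => (x i)^-1).
Proof. by apply/uclsP; apply: almostI (repr_ucls x) (repr_ucls x) _ => i ->. Qed.

Lemma uclsW (P : ultraproduct -> Prop) : (forall x, P (ucls x)) -> forall x, P x.
Proof. by move=> Px x; rewrite -(uclsK x). Qed.

Lemma ucls_ext x y : (forall i, x i = y i) -> ucls x = ucls y.
Proof. by move=> xy; apply/uclsP/almost_all. Qed.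

Definition uzero := ucls (fun i => 0).
Definition uone := ucls (fun i => 1).

Lemma uaddA : associative uadd.
Proof.
elim/uclsW=> x; elim/uclsW=> y; elim/uclsW=> z; rewrite !uaddE.
by apply: ucls_ext => i; rewrite addrA.
Qed.
Lemma uaddC : commutative uadd.
Proof.
by elim/uclsW=> x; elim/uclsW=> y; rewrite !uaddE; apply: ucls_ext => i; rewrite addrC.
Qed.
Lemma uadd0 : left_id uzero uadd.
Proof. by elim/uclsW=> x; rewrite uaddE; apply: ucls_ext => i; rewrite add0r. Qed.
Lemma uaddN : left_inverse uzero uopp uadd.
Proof. by elim/uclsW=> x; rewrite uoppE uaddE; apply: ucls_ext => i; rewrite addNr. Qed.
HB.instance Definition _ := GRing.isZmodule.Build ultraproduct uaddA uaddC uadd0 uaddN.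

Lemma umulA : associative umul.
Proof.
elim/uclsW=> x; elim/uclsW=> y; elim/uclsW=> z; rewrite !umulE.
by apply: ucls_ext => i; rewrite mulrA.
Qed.
Lemma umulC : commutative umul.
Proof.
by elim/uclsW=> x; elim/uclsW=> y; rewrite !umulE; apply: ucls_ext => i; rewrite mulrC.
Qed.
Lemma umul1 : left_id uone umul.
Proof. by elim/uclsW=> x; rewrite umulE; apply: ucls_ext => i; rewrite mul1r. Qed.
Lemma umulDl : left_distributive umul uadd.
Proof.
elim/uclsW=> x; elim/uclsW=> y; elim/uclsW=> z; rewrite !(umulE, uaddE).
by apply: ucls_ext => i; rewrite mulrDl.
Qed.
Lemma uone_neq0 : uone != uzero.
Proof. by apply/eqP=> /uclsP /filter_ex[i /eqP]; rewrite oner_eq0. Qed.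
HB.instance Definition _ := GRing.Zmodule_isComNzRing.Build ultraproduct
  umulA umulC umul1 umulDl uone_neq0.

Lemma umulV x : x != 0 -> uinv x * x = 1.
Proof.
elim/uclsW: x => x x0; rewrite uinvE [LHS]umulE; apply/uclsP.
case: (in_ultra_setVsetC (fun i => x i = 0) UU) => [Ux|].
  by move/eqP: x0; case; apply/uclsP.
by apply: filterS => i /eqP xi; rewrite mulVf.
Qed.

Lemma uinv0 : uinv 0 = 0.
Proof. by rewrite [LHS]uinvE; apply: ucls_ext => i; rewrite invr0. Qed.

HB.instance Definition _ := GRing.ComNzRing_isField.Build ultraproduct umulV uinv0.

End Ultraproduct.

Lemma ultraproduct_exists (I : Type) (U : set_system I) (UU : UltraFilter U) (E : I -> fieldType) :
  exists (K : fieldType) (cl : (forall i, E i) -> K),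
    [/\ forall z, exists x, z = cl x,
        forall x y, cl x = cl y <-> U (fun i => x i = y i),
        cl (fun=> 1) = 1,
        forall x y, cl x - cl y = cl (fun i => x i - y i) &
        forall x y, cl x * cl y = cl (fun i => x i * y i)].
Proof.
exists (ultraproduct UU E), (ucls UU (E := E)); split=> // [z|x y|x y|x y].
- by exists (urep z); rewrite uclsK.
- exact: uclsP.
- by rewrite -[RHS]uaddE -uoppE.
- by rewrite -[RHS]umulE.
Qed.

(** * Product rings and transfer to ultraproducts *)

Section ProductRing.
Variables (I : Type) (i0 : I) (E : I -> fieldType).

(** The argument [i0] witnesses an inhabited index set, so that 1 differs from 0. The ring structure
    lets matrices be mapped by projections to the factors and by [cl] to the ultraproduct. *)
Definition prodring of I := forall i, E i.
Let R := prodring i0.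
HB.instance Definition _ := gen_eqMixin R.
HB.instance Definition _ := gen_choiceMixin R.

Local Notation ext := (@functional_extensionality_dep _ _ _ _).
Let add (x y : R) : R := fun i => x i + y i.
Let opp (x : R) : R := fun i => - x i.
Let mul (x y : R) : R := fun i => x i * y i.
Let zero : R := fun=> 0.
Let one : R := fun=> 1.

Let addA : associative add.
Proof. by move=> x y z; apply: ext => i; rewrite /add addrA. Qed.
Let addC : commutative add.
Proof. by move=> x y; apply: ext => i; rewrite /add addrC. Qed.
Let add0 : left_id zero add.
Proof. by move=> x; apply: ext => i; rewrite /add add0r. Qed.
Let addN : left_inverse zero opp add.
Proof. by move=> x; apply: ext => i; rewrite /add addNr. Qed.
HB.instance Definition _ := GRing.isZmodule.Build R addA addC add0 addN.

Let mulA : associative mul.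
Proof. by move=> x y z; apply: ext => i; rewrite /mul mulrA. Qed.
Let mulC : commutative mul.
Proof. by move=> x y; apply: ext => i; rewrite /mul mulrC. Qed.
Let mul1 : left_id one mul.
Proof. by move=> x; apply: ext => i; rewrite /mul mul1r. Qed.
Let mulDl : left_distributive mul add.
Proof. by move=> x y z; apply: ext => i; rewrite /mul /add mulrDl. Qed.
Let one0 : one != zero.
Proof. by apply/eqP=> /(congr1 (fun x : R => x i0)) /eqP; rewrite oner_eq0. Qed.
HB.instance Definition _ := GRing.Zmodule_isComNzRing.Build R mulA mulC mul1 mulDl one0.

Lemma prodring_proj i : exists p : {rmorphism R -> E i}, forall x, p x = x i.
Proof. exact: rmorphism_exists. Qed.

Lemma prodring_diag (k : fieldType) (f : forall i, {rmorphism k -> E i}) :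
  exists d : {rmorphism k -> R}, forall x i, d x i = f i x.
Proof.
have [] := @rmorphism_exists k R (fun x i => f i x).
- by apply: ext => i; rewrite rmorph1.
- by move=> x y; apply: ext => i; rewrite rmorphB.
- by move=> x y; apply: ext => i; rewrite rmorphM.
by move=> d dE; exists d => x i; rewrite dE.
Qed.

Lemma ultraproduct_of_prodring (U : set_system I) (UU : UltraFilter U) :
  exists (K : fieldType) (cl : {rmorphism R -> K}),
    (forall z, exists x, z = cl x) /\ forall x y, cl x = cl y <-> U (fun i => x i = y i).
Proof.
have [K [cl [cls clP cl1 clB clM]]] := ultraproduct_exists UU E.
have [] := @rmorphism_exists R K cl => // cl' clE.
by exists K, cl'; split=> [z|x y]; rewrite ?clE //; have [x ->] := cls z; exists x.
Qed.
End ProductRing.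

Lemma map_mx_surj (R S : Type) (f : R -> S) m n (M : 'M[S]_(m, n)) :
  (forall y, exists x, y = f x) -> exists P, M = map_mx f P.
Proof.
move=> /choice[g gf]; exists (\matrix_(i, j) g (M i j)).
by apply/matrixP=> i j; rewrite !mxE.
Qed.

Section Los.
Variables (I : Type) (i0 : I) (E : I -> fieldType) (k K : fieldType).
Variables (U : set_system I) (UU : UltraFilter U) (f : forall i, {rmorphism k -> E i}).
Variables (cl : {rmorphism prodring E i0 -> K}) (d : {rmorphism k -> prodring E i0}).
Hypotheses (cl_surj : forall z, exists x, z = cl x)
  (clP : forall x y, cl x = cl y <-> U (fun i => x i = y i))
  (dE : forall x i, d x i = f i x).

Lemma ultra_mx m n (M M' : 'M[prodring E i0]_(m, n)) :
  map_mx cl M = map_mx cl M' -> U (fun i => forall r c, M r c i = M' r c i).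
Proof.
move=> /matrixP MM'; apply: filter_forall => r; apply: filter_forall => c.
by apply/clP; have := MM' r c; rewrite !mxE.
Qed.

Lemma map_proj_diag i (p : {rmorphism prodring E i0 -> E i}) m n (A : 'M[k]_(m, n)) :
  (forall x, p x = x i) -> map_mx p (map_mx d A) = map_mx (f i) A.
Proof. by move=> pE; apply/matrixP=> r c; rewrite !mxE pE dE. Qed.

Lemma ultra_aniso N (A : 'M[k]_N) :
  (forall i, aniso (map_mx (f i) A)) -> aniso (map_mx (cl \o d) A).
Proof.
move=> anA z; have [Z ->] := map_mx_surj z cl_surj.
rewrite map_mx_comp qf_map -(rmorph0 cl) => /clP qZ.
apply/rowP=> j; rewrite !mxE -(rmorph0 cl); apply/clP; apply: filterS qZ => i.
have [p pE] := prodring_proj i0 E i; rewrite -!pE -qf_map (map_proj_diag _ pE) rmorph0.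
by move=> /anA /rowP/(_ j); rewrite !mxE.
Qed.

(** The matrix of an isometry lifts to the product ring, and its finitely many equations hold
    together at almost every index. Non-isometry in all factors thus passes to the ultraproduct. *)
Lemma ultra_iso N (A B : 'M[k]_N) :
  iso (map_mx (cl \o d) A) (map_mx (cl \o d) B) ->
  exists i, iso (map_mx (f i) A) (map_mx (f i) B).
Proof.
move=> [P [E1 E2]]; have [Q PQ] := map_mx_surj P cl_surj; move: E1 E2; rewrite {}PQ.
rewrite !(map_mx_comp d cl) map_trmx -!map_mxM !map_trmx -!map_mxD => /ultra_mx U1 E2.
have U2 : U (fun i => forall r, (Q *m map_mx d B *m Q^T) r r i = map_mx d A r r i).
  by apply: filter_forall => r; apply/clP; have := E2 r; rewrite !map_mxE.
have [i [H1 H2]] := filter_ex (filterI U1 U2).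
have [p pE] := prodring_proj i0 E i; exists i, (map_mx p Q).
rewrite -!(map_proj_diag _ pE) map_trmx -!map_mxM; split=> [|r].
  rewrite !map_trmx -!map_mxD; apply/matrixP=> r c.
  by rewrite [LHS]map_mxE [RHS]map_mxE; apply: etrans (pE _) (etrans _ (esym (pE _))).
by rewrite [LHS]map_mxE [RHS]map_mxE; apply: etrans (pE _) (etrans _ (esym (pE _))).
Qed.
End Los.

(** * Closure under resolving all quadratic extensions *)

Section Closure.
Variables (k : fieldType) (ch2 : 2%N \in [pchar k]) (n : nat).
Variables (b : nat -> k) (a : k) (c : nat -> k) (d : k).
Hypotheses (n_gt0 : (0 < n)%N) (b0 : forall i, b i != 0) (c0 : forall i, c i != 0).
Let A := pfm n b a.
Let A' := pfm n c d.

Definition good (E : fieldType) (f : {rmorphism k -> E}) :=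
  [/\ aniso (map_mx f A), aniso (map_mx f A') & ~ iso (map_mx f A) (map_mx f A')].

(** If t^2 + e t = x in an extension, then t e0 + y has value t^2 + e t + x = 0, so such a [y] makes
    the form isotropic there. *)
Definition attains_at (E : fieldType) (f : {rmorphism k -> E}) (B : 'M[k]_(pfdim n.+1))
    (x : E) (e : bool) y :=
  qf (map_mx f B) y = x /\ bf (map_mx f B) (pf1 E n) y = e%:R.

Definition attains (E : fieldType) (f : {rmorphism k -> E}) B x e :=
  exists y, attains_at f B x e y.

(* Either X^2 + e X - x splits, or its splitting field splits both forms. *)
Definition resolved (E : fieldType) (f : {rmorphism k -> E}) (x : E) (e : bool) :=
  (exists t, t ^+ 2 + e%:R * t = x) \/ (attains f A x e /\ attains f A' x e).

Lemma attains_at_map (E E' : fieldType) (f : {rmorphism k -> E}) (g : {rmorphism E -> E'})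
    (f' : {rmorphism k -> E'}) B x e y :
  f' =1 g \o f -> attains_at f' B (g x) e (map_mx g y) <-> attains_at f B x e y.
Proof.
move=> f'E; rewrite /attains_at.
have -> : map_mx f' B = map_mx g (map_mx f B).
  by apply/matrixP=> i j; rewrite !map_mxE f'E.
rewrite qf_map -(map_pf1 g) bf_map -(rmorph_nat g).
by split=> -[E1 E2]; split; rewrite ?E1 ?E2 //; apply: (fmorph_inj g).
Qed.

Lemma attains_map (E E' : fieldType) (f : {rmorphism k -> E}) (g : {rmorphism E -> E'})
    (f' : {rmorphism k -> E'}) B x e :
  f' =1 g \o f -> attains f B x e -> attains f' B (g x) e.
Proof. by move=> f'E [y yP]; exists (map_mx g y); apply/(attains_at_map _ _ _ _ f'E). Qed.

Lemma resolved_map (E E' : fieldType) (f : {rmorphism k -> E}) (g : {rmorphism E -> E'})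
    (f' : {rmorphism k -> E'})    x e : f' =1 g \o f -> resolved f x e -> resolved f' (g x) e.
Proof.
move=> f'E [[t tx]|[rA rA']]; last by right; split; apply: attains_map; eauto.
by left; exists (g t); rewrite -tx rmorphD rmorphM rmorphXn rmorph_nat.
Qed.

(** The default [t0] covers indices without a witness: in an ultraproduct witnesses exist only
    almost everywhere. *)
Lemma dep_choice (I : Type) (T : I -> Type) (t0 : forall i, T i) (P : forall i, T i -> Prop) :
  exists t : forall i, T i, forall i, (exists u, P i u) -> P i (t i).
Proof.
have H i : exists t, (exists u, P i u) -> P i t.
  by have [[u Pu]|nP] := pselect (exists u, P i u); [exists u | exists (t0 i)].
by exists (fun i => projT1 (cid (H i))) => i; exact: (projT2 (cid (H i))).
Qed.

Section UltraResolved.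
Variables (I : Type) (i0 : I) (E : I -> fieldType) (K : fieldType).
Variables (U : set_system I) (UU : UltraFilter U) (f : forall i, {rmorphism k -> E i}).
Variables (cl : {rmorphism prodring E i0 -> K}) (dg : {rmorphism k -> prodring E i0}).
Hypotheses (clP : forall x y, cl x = cl y <-> U (fun i => x i = y i))
  (dgE : forall x i, dg x i = f i x).

Lemma ultra_root (x : prodring E i0) (e : bool) :
  U (fun i => exists t, t ^+ 2 + e%:R * t = x i) -> exists t, t ^+ 2 + e%:R * t = cl x.
Proof.
move=> Ux; have [t tP] := dep_choice (fun i => 0) (fun i t => t ^+ 2 + e%:R * t = x i).
exists (cl t); rewrite -rmorphXn -(rmorph_nat cl) -rmorphM -rmorphD; apply/clP.
apply: filterS Ux => i /tP; have [p pE] := prodring_proj i0 E i.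
by rewrite -!pE => <-; rewrite rmorphD rmorphXn rmorphM rmorph_nat.
Qed.

Lemma ultra_attains_at B (x : prodring E i0) (e : bool) (Y : 'rV[prodring E i0]_(pfdim n.+1)) :
  U (fun i => attains_at (f i) B (x i) e (\row_j Y 0 j i)) ->
  attains_at (cl \o dg) B (cl x) e (map_mx cl Y).
Proof.
move=> Ux.
have Yp i (p : {rmorphism prodring E i0 -> E i}) : (forall x, p x = x i) ->
    map_mx p Y = \row_j Y 0 j i.
  by move=> pE; apply/rowP=> j; rewrite !mxE pE.
rewrite /attains_at map_mx_comp qf_map -(map_pf1 cl) bf_map -(rmorph_nat cl).
split; apply/clP; apply: filterS Ux => i [qy by_]; have [p pE] := prodring_proj i0 E i.
  by rewrite -[LHS]pE -qf_map (map_proj_diag dgE B pE) (Yp _ _ pE).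
rewrite -[LHS]pE -[RHS]pE rmorph_nat -bf_map (map_proj_diag dgE B pE) (Yp _ _ pE).
by rewrite map_pf1.
Qed.

Lemma ultra_attains B (x : prodring E i0) (e : bool) :
  U (fun i => attains (f i) B (x i) e) -> attains (cl \o dg) B (cl x) e.
Proof.
move=> Ux; have [y yP] := dep_choice (fun i => 0)
  (fun i (y : 'rV_(pfdim n.+1)) => attains_at (f i) B (x i) e y).
pose Y : 'rV[prodring E i0]_(pfdim n.+1) := \row_j (fun i => y i 0 j).
exists (map_mx cl Y); apply: ultra_attains_at; apply: filterS Ux => i /yP.
by congr attains_at; apply/rowP=> j; rewrite !mxE.
Qed.

End UltraResolved.

Lemma good_eq (E : fieldType) (f f' : {rmorphism k -> E}) : f =1 f' -> good f -> good f'.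
Proof.
move=> ff' [g1 g2 g3]; have E1 (B : 'M[k]_(pfdim n.+1)) : map_mx f' B = map_mx f B.
  by apply/matrixP=> i j; rewrite !map_mxE ff'.
by split; rewrite !E1.
Qed.

(** [resolve_step] supplies a vector for its second form only, so it is applied twice with the roles
    exchanged; the flag [s] of [half] selects the form. A root met on the way persists and resolves
    the pair. *)
Lemma good_resolve1 (E : fieldType) (f : {rmorphism k -> E}) x e : good f ->
  exists (E' : fieldType) (g : {rmorphism E -> E'}),
    good (g \o f) /\ resolved (g \o f) (g x) e.
Proof.
move=> gf; have bool_idem (K : fieldType) : (e%:R : K) ^+ 2 = e%:R.
  by case: e; rewrite ?expr1n ?expr0n.
have half (K : fieldType) (h : {rmorphism k -> K}) (z : K) (s : bool) : good h ->
    exists (E' : fieldType) (g : {rmorphism K -> E'}), good (g \o h) /\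
      ((exists t, t ^+ 2 + e%:R * t = g z) \/ attains (g \o h) (if s then A else A') (g z) e).
  move=> [g1 g2 g3]; have chK := rmorph_pchar h ch2.
  have [[t tz]|nt] := pselect (exists t, t ^+ 2 + e%:R * t = z).
    by exists K, idfun; split; [apply: good_eq (And3 g1 g2 g3) | left; exists t].
  have nt' t : t ^+ 2 + e%:R * t <> z by move=> tz; apply: nt; exists t.
  have hb i : (h \o b) i != 0 by rewrite /= fmorph_eq0.
  have hc i : (h \o c) i != 0 by rewrite /= fmorph_eq0.
  have map2 (K' : fieldType) (g : {rmorphism K -> K'}) B :
    map_mx (g \o h) B = map_mx g (map_mx h B) by move=> *; exact: map_mx_comp.
  case: s.
    have g4 : ~ iso (map_mx h A') (map_mx h A) by move=> /(aniso_iso_sym g2).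
    move: (g1) (g2) g4; rewrite !map_pfm => h1 h2 h3.
    have [K' [g [k1 k2 k3 [y [qy by_]]]]] :=
      resolve_step chK n_gt0 hc hb h2 h1 h3 (bool_idem K) nt'.
    exists K', g; rewrite -!map_pfm in k1 k2 k3 qy by_; split.
      by split; rewrite ?map2 // => /(aniso_iso_sym k2).
    by right; exists y; rewrite /attains_at !map2 qy by_ rmorph_nat.
  move: (g1) (g2) g3; rewrite !map_pfm => h1 h2 h3.
  have [K' [g [k1 k2 k3 [y [qy by_]]]]] :=
    resolve_step chK n_gt0 hb hc h1 h2 h3 (bool_idem K) nt'.
  exists K', g; rewrite -!map_pfm in k1 k2 k3 qy by_; split; first by split; rewrite !map2.
  by right; exists y; rewrite /attains_at !map2 qy by_ rmorph_nat.
have [E1 [g1 [gg1 r1]]] := half E f x true gf.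
have [E2 [g2 [gg2 r2]]] := half E1 (g1 \o f) (g1 x) false gg1.
exists E2, (g2 \o g1); split; first exact: good_eq gg2.
case: r2 => [r2|r2]; first by left.
case: r1 => [[t tx]|r1].
  by left; exists (g2 t); rewrite /= -tx rmorphD rmorphM rmorphXn rmorph_nat.
right; split; last exact: r2.
exact: attains_map r1.
Qed.

Lemma good_resolve_seq (E : fieldType) (f : {rmorphism k -> E}) (s : seq (E * bool)) :
  good f -> exists (E' : fieldType) (g : {rmorphism E -> E'}), good (g \o f) /\
    forall z, z \in s -> resolved (g \o f) (g z.1) z.2.
Proof.
move=> gf; elim: s => [|z s [E1 [g1 [gg1 r1]]]].
  by exists E, idfun; split=> //; exact: good_eq gf.
have [E2 [g2 [gg2 r2]]] := good_resolve1 (g1 z.1) z.2 gg1.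
exists E2, (g2 \o g1); split=> [|y]; first exact: good_eq gg2.
rewrite inE => /orP[/eqP ->|/r1]; last exact: resolved_map.
exact: r2.
Qed.

(** Compactness: the fields resolving finite lists of pairs are indexed by those lists, and the
    ultrafilter refines the cones of lists containing a given one. Each pair lies in almost every
    list. *)
Lemma good_resolve_all (E : fieldType) (f : {rmorphism k -> E}) :
  good f -> exists (E' : fieldType) (g : {rmorphism E -> E'}), good (g \o f) /\
    forall x e, resolved (g \o f) (g x) e.
Proof.
move=> gf; pose I := seq (E * bool).
pose Es (s : I) := projT1 (cid (good_resolve_seq s gf)).
pose gP (s : I) := cid (projT2 (cid (good_resolve_seq s gf))).
pose gs (s : I) : {rmorphism E -> Es s} := projT1 (gP s).
have gsP s : good (gs s \o f) /\ forall z, z \in s -> resolved (gs s \o f) (gs s z.1) z.2.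
  exact: (projT2 (gP s)).
pose cone : set_system I := fun P => exists s : I, forall t : I, {subset s <= t} -> P t.
have coneP : ProperFilter cone.
  apply: Build_ProperFilter_ex => [P [s Ps]|]; first by exists s; exact: Ps.
  split=> [|P Q [s Ps] [t Qt]|P Q PQ [s Ps]]; first by exists [::].
    exists (s ++ t) => u su; split; [apply: Ps|apply: Qt] => z zs; apply: su;
    by rewrite mem_cat zs ?orbT.
  by exists s => t /Ps/PQ.
have [U [UU coneU]] := ultraFilterLemma coneP.
have [K [cl [cls clP]]] := ultraproduct_of_prodring ([::] : I) Es UU.
have [dE dEP] := prodring_diag ([::] : I) gs.
have gK : good ((cl \o dE) \o f).
  have fE x i : (dE \o f) x i = (gs i \o f) x by rewrite /= dEP.
  apply: (@good_eq _ (cl \o (dE \o f))) => //; split.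
  - by apply: (ultra_aniso UU cls clP fE) => s; have [[]] := gsP s.
  - by apply: (ultra_aniso UU cls clP fE) => s; have [[]] := gsP s.
  - by move=> /(ultra_iso UU cls clP fE)[s]; have [[]] := gsP s.
exists K, (cl \o dE); split=> // x e; rewrite /=.
have Uxe : U (fun s => (x, e) \in s) by apply: coneU; exists [:: (x, e)] => t; apply; rewrite inE.
case: (in_ultra_setVsetC (fun s => exists t, t ^+ 2 + e%:R * t = gs s x) UU) => Ux.
  left; apply: (ultra_root UU clP); apply: filterS Ux => s [t tx]; exists t; rewrite tx.
  by rewrite dEP.
have fE y i : (dE \o f) y i = (gs i \o f) y by rewrite /= dEP.
right; split; apply: (ultra_attains UU clP fE); apply: filterS2 Ux Uxe => s nt xs;
  by have [_ /(_ _ xs)[]] := gsP s => //= -[r r']; rewrite dEP.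
Qed.

Definition state := {E : fieldType & {f : {rmorphism k -> E} | good f}}.

Lemma next_state (S : state) : exists (S' : state) (g : {rmorphism projT1 S -> projT1 S'}),
  sval (projT2 S') =1 g \o sval (projT2 S) /\
  forall x e, resolved (sval (projT2 S')) (g x) e.
Proof.
case: S => E [f gf]; have [E' [g [gg rg]]] := good_resolve_all gf.
by exists (existT _ E' (@exist {rmorphism k -> E'} (@good E') (g \o f) gg)), g.
Qed.

Lemma leq_rect (P : nat -> Prop) M :
  P M -> (forall m, (M <= m)%N -> P m -> P m.+1) -> forall m, (M <= m)%N -> P m.
Proof.
move=> PM PS m Mm; rewrite -(subnK Mm); elim: (m - M)%N => // j IHj.
by rewrite addSn; apply: PS; rewrite ?leq_addl.
Qed.

(** The induction passes to the shifted tower; entries below [N] are arbitrary, here 0. *)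
Lemma extend_coherent (L : nat -> fieldType) (g : forall i, L i -> L i.+1) N (x : L N) :
  exists s : forall i, L i, s N = x /\ forall m, (N <= m)%N -> s m.+1 = g m (s m).
Proof.
elim: N => [|N IHN] in L g x *; first by exists (nat_rect L x g).
have [s [sN sg]] := IHN (fun i => L i.+1) (fun i => g i.+1) x.
exists (fun i => match i with 0 => 0 | i'.+1 => s i' end); split=> // -[//|m].
exact: sg.
Qed.

(** The union of the tower is realized in the ultraproduct of its stages, as the classes of
    eventually coherent sequences. An element known at stage [N] is resolved at stage [N.+1], and
    the root or vector found there extends coherently. *)
Lemma good_closure (E : fieldType) (f : {rmorphism k -> E}) :
  good f -> exists (E' : fieldType) (g : {rmorphism k -> E'}),
    good g /\ forall x e, resolved g x e.
Proof.
move=> gf; pose next S := projT1 (cid (next_state S)).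
pose S i := iter i next (existT _ E (@exist {rmorphism k -> E} (@good E) f gf) : state).
pose L i := projT1 (S i).
pose fs i : {rmorphism k -> L i} := sval (projT2 (S i)).
have fsP i : good (fs i) := svalP (projT2 (S i)).
pose nP i := cid (projT2 (cid (next_state (S i)))).
pose g i : {rmorphism L i -> L i.+1} := projT1 (nP i).
have gP i : fs i.+1 =1 g i \o fs i /\ forall x e, resolved (fs i.+1) (g i x) e.
  exact: (projT2 (nP i)).
have [U [UU evU]] := ultraFilterLemma eventually_filter.
have geU N : U (fun m => (N <= m)%N) by apply: evU; exists N.
have [W [cl [cls clP]]] := ultraproduct_of_prodring 0%N L UU.
have [dk dkE] := prodring_diag 0%N fs.
pose coh (s : prodring L 0%N) N := forall m, (N <= m)%N -> s m.+1 = g m (s m).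
pose S' z := exists s N, z = cl s /\ coh s N.
have S1 : S' 1.
  by exists 1, 0%N; split=> [|m _]; rewrite ?rmorph1 //; apply/esym; exact: rmorph1.
have SB x y : S' x -> S' y -> S' (x - y).
  move=> [s [N [-> sN]]] [t [M [-> tM]]]; exists (s - t), (maxn N M).
  split=> [|m]; first by rewrite rmorphB.
  rewrite geq_max => /andP[/sN sm /tM tm]; apply/esym; apply: etrans (rmorphB (g m) _ _) _.
  by rewrite -sm -tm.
have SM x y : S' x -> S' y -> S' (x * y).
  move=> [s [N [-> sN]]] [t [M [-> tM]]]; exists (s * t), (maxn N M).
  split=> [|m]; first by rewrite rmorphM.
  rewrite geq_max => /andP[/sN sm /tM tm]; apply/esym; apply: etrans (rmorphM (g m) _ _) _.
  by rewrite -sm -tm.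
have SV x : S' x -> S' x^-1.
  move=> [s [N [-> sN]]]; pose t : prodring L 0%N := fun i => (s i)^-1.
  exists t, N; split=> [|m /sN sm]; last by rewrite /t sm fmorphV.
  have [s0|s0] := eqVneq (cl s) 0.
    rewrite s0 invr0 -(rmorph0 cl); apply/clP; move: s0; rewrite -(rmorph0 cl) => /clP.
    by apply: filterS => i si; rewrite /t si; apply/esym; exact: invr0.
  apply: (mulfI s0); rewrite divff // -rmorphM -(rmorph1 cl); apply/clP.
  (* [s] vanishes almost everywhere or almost nowhere; in the second case the pointwise inverse is
     an inverse. *)
  case: (in_ultra_setVsetC (fun i => s i = 0) UU) => [Us|].
    by case/eqP: s0; rewrite -(rmorph0 cl); apply/clP.
  by apply: filterS => i /eqP si; apply/esym; exact: divff.
have [|||K [r rP]] := @subfield_exists W S' => // [x y Sx Sy|]; first by apply: SM => //; exact: SV.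
have [h hE] : exists h : {rmorphism k -> K}, forall x, r (h x) = (cl \o dk) x.
  apply: rmorphism_lift => x; apply/rP; exists (dk x), 0%N; split=> // m _.
  by rewrite !dkE; have [->] := gP m.
have rh p q (B : 'M[k]_(p, q)) : map_mx r (map_mx h B) = map_mx (cl \o dk) B.
  by apply/matrixP=> i j; rewrite !map_mxE hE.
exists K, h; split.
  split; try by apply: (aniso_inj (f := r)); rewrite rh;
    apply: (ultra_aniso UU cls clP dkE) => i; have [] := fsP i.
  by move=> /(map_iso r); rewrite !rh => /(ultra_iso UU cls clP dkE)[i]; have [] := fsP i.
move=> x e; have [s [N [rx sN]]] := (rP (r x)).2 (ex_intro _ x erefl).
have [_ /(_ (s N) e)] := gP N; rewrite -sN //.
have {}sN : coh s N.+1 by move=> m Nm; apply: sN; apply: ltnW.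
move: N.+1 sN => M sM [[t tx]|rAA'].
  left; have [tau [tauM tauP]] := extend_coherent (fun i => g i) t.
  have Stau : S' (cl tau) by exists tau, M.
  have [y yE] := (rP _).1 Stau; exists y; apply: (fmorph_inj r).
  rewrite rmorphD rmorphXn rmorphM rmorph_nat yE rx -rmorphXn -(rmorph_nat cl) -rmorphM -rmorphD.
  have tauE m : (M <= m)%N -> tau m ^+ 2 + e%:R * tau m = s m.
    apply: (leq_rect (P := fun m => tau m ^+ 2 + e%:R * tau m = s m)); first by rewrite tauM.
    by move=> {}m Mm IHm; rewrite tauP // sM // -IHm rmorphD rmorphXn rmorphM rmorph_nat.
  apply/clP; apply: filterS (geU M) => m /tauE.
  have [p pE] := prodring_proj 0%N L m.
  by rewrite -!pE rmorphD rmorphXn rmorphM rmorph_nat.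
right; suff att B : attains (fs M) B (s M) e -> attains h B x e.
  by case: rAA' => rA rA'; split; apply: att.
move=> [y yP].
have /fin_all_exists[tau tauP] : forall j, exists tj : forall i, L i,
    tj M = y 0 j /\ coh tj M.
  by move=> j; have [tj [tM tP]] := extend_coherent (fun i => g i) (y 0 j); exists tj.
have /fin_all_exists[z zE] : forall j, exists z, r z = cl (tau j).
  by move=> j; apply/rP; exists (tau j), M; case: (tauP j).
exists (\row_j z j).
apply/(attains_at_map (f' := cl \o dk) (g := r)) => [t|]; first by rewrite /= hE.
have -> : map_mx r (\row_j z j) = map_mx cl (\row_j (tau j : prodring L 0%N)).
  by apply/rowP=> j; rewrite !mxE zE.
rewrite rx; apply: (ultra_attains_at UU clP dkE); apply: filterS (geU M).
apply: (leq_rect (P := fun m => attains_at (fs m) B (s m) e (\row_j (\row_j tau j) 0 j m))).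
  by congr attains_at: yP; apply/rowP=> j; rewrite !mxE; case: (tauP j).
move=> m Mm IHm; rewrite sM //.
have -> : \row_j (\row_j (tau j : prodring L 0%N)) 0 j m.+1 =
   map_mx (g m) (\row_j (\row_j (tau j : prodring L 0%N)) 0 j m).
  by apply/rowP=> j; rewrite !mxE; case: (tauP j) => _ ->.
by apply/(attains_at_map (f := fs m)) => //; have [] := gP m.
Qed.
End Closure.

(** * Abstract forms and matrices *)

Lemma linear_exists (R : nzRingType) (V W : lmodType R) (g : V -> W) :
  linear g -> exists h : {linear V -> W}, h =1 g.
Proof.
move=> gL; pose gm := GRing.isLinear.Build R V W *:%R g gL.
pose h : {linear V -> W} := HB.pack g gm.
by exists h.
Qed.

Definition presents (F : fieldType) (V : vectType F) (q : quadform V) N (A : 'M[F]_N) :=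
  exists g : {linear V -> 'rV[F]_N}, bijective g /\ forall v, qf A (g v) = q v.

Lemma linear_inv (F : fieldType) (V W : lmodType F) (g : {linear V -> W}) :
  bijective g -> exists h : {linear W -> V}, cancel g h /\ cancel h g.
Proof.
move=> [h gK hK]; have [|h' h'E] := @linear_exists F W V h.
  by move=> c u v; apply: (can_inj gK); rewrite linearP !hK.
by exists h'; split=> x; rewrite h'E.
Qed.

Lemma is_quadratic_qf (F : fieldType) N (A : 'M[F]_N) : is_quadratic (qf A).
Proof.
have pE u v : polar (qf A) u v = bf A u v by rewrite /polar qfD; ring.
by split=> [c v|c u v w]; rewrite ?qfZ // !pE bfDl bfZl.
Qed.

(** [scalar_ext] uses the coordinates of [vbasis]; the matrix [G] from these to the given ones is
    invertible over [F], hence over [E]. *)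
Lemma presents_scalar_ext (F E : fieldType) (f : {rmorphism F -> E}) (V : vectType F)
    (q : quadform V) N (A : 'M[F]_N) :
  presents q A -> presents (scalar_ext f q) (map_mx f A).
Proof.
move=> [g [gB gq]]; have [h [gK hK]] := linear_inv gB.
set n := \dim {:V}; pose e (i : 'I_n) : V := (vbasis {:V})`_i.
have [|L1 L1E] := @linear_exists F 'rV[F]_n 'rV[F]_N (fun x => g (\sum_i x 0 i *: e i)).
  move=> c x y; rewrite -linearP; congr (g _); rewrite scaler_sumr -big_split.
  by apply: eq_bigr => i _; rewrite !mxE scalerDl scalerA.
have [|L2 L2E] := @linear_exists F 'rV[F]_N 'rV[F]_n
   (fun y => \row_i coord (vbasis {:V}) i (h y)).
  by move=> c x y; apply/rowP=> i; rewrite !mxE !linearP.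
pose G := lin1_mx L1; pose G' := lin1_mx L2.
have eE v : \sum_i coord (vbasis {:V}) i v *: e i = v.
  by rewrite [RHS](coord_vbasis (memvf v)).
have GG' : G *m G' = 1%:M.
  apply/row_matrixP=> i; rewrite !rowE mulmxA mulmx1 !mul_rV_lin1 L2E L1E gK.
  by apply/rowP=> j; rewrite mxE coord_sum_free ?(basis_free (vbasisP _)).
have G'G : G' *m G = 1%:M.
  apply/row_matrixP=> i; rewrite !rowE mulmxA mulmx1 !mul_rV_lin1 L1E L2E.
  rewrite -[RHS]hK -[h _ in RHS]eE; congr (g _).
  by apply: eq_bigr => j _; rewrite mxE.
have [|M ME] := @linear_exists E 'rV[E]_n 'rV[E]_N (fun x => x *m map_mx f G).
  by move=> c x y; rewrite mulmxDl scalemxAl.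
exists M; split.
  exists (fun y => y *m map_mx f G') => x; rewrite ME -mulmxA -map_mxM;
  by rewrite ?GG' ?G'G map_mx1 mulmx1.
move=> x; rewrite ME mulmx_sum_row.
pose Q := QuadForm (is_quadratic_qf (map_mx f A)).
have rG i : row i (map_mx f G) = map_mx f (g (e i)).
  rewrite -map_row rowE mul_rV_lin1 L1E (bigD1 i) //= mxE !eqxx scale1r big1 ?addr0 //.
  by move=> j /negbTE ji; rewrite mxE eqxx ji scale0r.
apply: etrans (quadratic_sum Q _ _) _; rewrite /=; congr (_ + _).
  by apply: eq_bigr => i _; rewrite rG qf_map gq.
apply: eq_bigr => i _; apply: eq_bigr => j _; congr (_ * _).
by rewrite /polar !rG -map_mxD !qf_map -linearD !gq !rmorphB.
Qed.

Lemma presents_aniso (F : fieldType) (V : vectType F) (q : quadform V) N (A : 'M[F]_N) :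
  presents q A -> aniso A -> anisotropic q.
Proof.
move=> [g [gB gq]] anA [v v0 qv]; case/eqP: v0; apply: (bij_inj gB).
by rewrite linear0; apply: anA; rewrite gq.
Qed.

Lemma aniso_presents (F : fieldType) (V : vectType F) (q : quadform V) N (A : 'M[F]_N) :
  presents q A -> anisotropic q -> aniso A.
Proof.
move=> [g [gB gq]] anq x qx; have [h [gK hK]] := linear_inv gB.
apply: contrapT => /eqP x0; apply: anq; exists (h x); last by rewrite -gq hK.
by apply: contra x0 => /eqP hx; rewrite -(hK x) hx linear0.
Qed.

Lemma isometric_iso (F : fieldType) (V V' : vectType F) (q : quadform V) (q' : quadform V')
    N (A A' : 'M[F]_N) :
  presents q A -> presents q' A' -> isometric q q' -> iso A A'.
Proof.
move=> [g [gB gq]] [g' [gB' gq']] [s [sB sq]]; have [h [gK hK]] := linear_inv gB.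
exists (lin1_mx (g' \o s \o h)); apply/qeqP=> x.
by rewrite -qf_mul mul_rV_lin1 /= gq' sq -gq hK.
Qed.

Lemma iso_isometric (F : fieldType) (V V' : vectType F) (q : quadform V) (q' : quadform V')
    N (A A' : 'M[F]_N) :
  presents q A -> presents q' A' -> aniso A -> iso A A' -> isometric q q'.
Proof.
move=> [g [gB gq]] [g' [gB' gq']] anA /(aniso_iso_unit anA)[P Pu qP].
have [h' [gK' hK']] := linear_inv gB'.
have [|M ME] := @linear_exists F 'rV[F]_N 'rV[F]_N (fun x => x *m P).
  by move=> c x y; rewrite mulmxDl scalemxAl.
exists (h' \o M \o g); split; last by move=> v; rewrite /= -gq' hK' ME qP gq.
apply: bij_comp => //; apply: bij_comp; first by exists g'.
by exists (fun x => x *m invmx P) => x; rewrite ME ?mulmxK ?mulmxKV.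
Qed.

(** * Sets of slots and the recursive Pfister matrix *)

Section Slots.
Variable m : nat.
Implicit Types (I : {set 'I_m}) (J : {set 'I_m.+1}).

Definition slot_lift I : {set 'I_m.+1} := [set widen_ord (leqnSn m) i | i in I].
Definition slot_drop J : {set 'I_m} := [set i | widen_ord (leqnSn m) i \in J].

Lemma ord_max_slot_lift I : (ord_max \in slot_lift I) = false.
Proof.
apply/negbTE/imsetP=> -[i _ /(congr1 val) /= E].
by have := ltn_ord i; rewrite -E ltnn.
Qed.

Lemma widen_slot_inj : injective (widen_ord (leqnSn m)).
Proof. by move=> i j /(congr1 val) /= ij; apply: val_inj. Qed.

Lemma mem_slot_lift I i : (widen_ord (leqnSn m) i \in slot_lift I) = (i \in I).
Proof. by rewrite mem_imset //; exact: widen_slot_inj. Qed.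

Lemma slot_liftK : cancel slot_lift slot_drop.
Proof. by move=> I; apply/setP=> i; rewrite inE mem_slot_lift. Qed.

Lemma slot_lift_maxK : cancel (fun I => ord_max |: slot_lift I) slot_drop.
Proof.
move=> I; apply/setP=> i; rewrite !inE mem_slot_lift; case: eqP => // /(congr1 val) /= E.
by have := ltn_ord i; rewrite E ltnn.
Qed.

Lemma slot_dropK J : (if ord_max \in J then ord_max |: slot_lift (slot_drop J)
                      else slot_lift (slot_drop J)) = J.
Proof.
have wid (i : 'I_m.+1) : i = ord_max \/ exists j, i = widen_ord (leqnSn m) j.
  have [lt_im|] := ltnP i m; first by right; exists (Ordinal lt_im); apply: val_inj.
  by move=> le_mi; left; apply: val_inj; have := ltn_ord i; move=> /=; lia.
apply/setP=> i; have [->|[j ->]] := wid i.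
  by case: ifP => _; rewrite ?inE ?eqxx ?ord_max_slot_lift.
have -> : (widen_ord (leqnSn m) j \in if ord_max \in J
      then ord_max |: slot_lift (slot_drop J) else slot_lift (slot_drop J)) =
   (widen_ord (leqnSn m) j \in slot_lift (slot_drop J)).
  case: ifP => // _; rewrite !inE; case: eqP => // /(congr1 val) /= E.
  by have := ltn_ord j; rewrite E ltnn.
by rewrite mem_slot_lift inE.
Qed.

Lemma sum_slots (R : nmodType) (F : {set 'I_m.+1} -> R) :
  \sum_J F J = \sum_I F (slot_lift I) + \sum_I F (ord_max |: slot_lift I).
Proof.
rewrite (bigID (fun J => ord_max \in J)) /= addrC; congr (_ + _).
  rewrite (reindex_onto slot_lift slot_drop) => [|J /negbTE Jm]; last first.
    by have := slot_dropK J; rewrite Jm.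
  by apply: eq_bigl => I; rewrite ord_max_slot_lift slot_liftK eqxx.
rewrite (reindex_onto (fun I => ord_max |: slot_lift I) slot_drop) => [|J Jm]; last first.
  by have := slot_dropK J; rewrite Jm.
by apply: eq_bigl => I; rewrite slot_lift_maxK eqxx !inE eqxx.
Qed.

Lemma prod_slot_lift (R : comNzRingType) (b : 'I_m.+1 -> R) I :
  \prod_(i in slot_lift I) b i = \prod_(i in I) b (widen_ord (leqnSn m) i).
Proof. by rewrite big_imset // => i j _ _; exact: widen_slot_inj. Qed.

Lemma prod_slot_max (R : comNzRingType) (b : 'I_m.+1 -> R) I :
  \prod_(i in ord_max |: slot_lift I) b i =
  b ord_max * \prod_(i in I) b (widen_ord (leqnSn m) i).
Proof. by rewrite big_setU1 ?ord_max_slot_lift //= prod_slot_lift. Qed.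

End Slots.

Local Notation plane F := (F^o * F^o)%type.

(** Sets of slots without and with [ord_max] index the two diagonal blocks of [pfm m.+1]. *)
Lemma presents_pfister (F : fieldType) m (b : 'I_m -> F) (b' : nat -> F) a :
  (forall i, b' (val i) = b i) -> presents (pfister b a) (pfm m b' a).
Proof.
elim: m b => [|m IHm] b bE.
  have set_eq (I : {set 'I_0}) : I = set0 by apply/setP=> -[].
  pose gf (p : {ffun {set 'I_0} -> plane F}) : 'rV[F]_(pfdim 1) :=
    row_mx (p set0).1%:M (p set0).2%:M.
  have [|g gE] := @linear_exists F _ _ gf.
    move=> c u v; rewrite /gf !ffunE /= scale_row_mx add_row_mx !scale_scalar_mx.
    by rewrite -!raddfD.
  exists g; split.
    exists (fun x : 'rV[F]_(1 + 1) => [ffun=> (x 0 (lshift 1 0), x 0 (rshift 1 0))]) => [p|x].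
      apply/ffunP=> I; rewrite ffunE gE /gf (row_mxEl (p set0).1%:M) (row_mxEr (p set0).1%:M).
      by rewrite !mxE !mulr1n (set_eq I); case: (p _).
    rewrite gE /gf !ffunE /=; have [s [t ->]] := row_split0 x.
    by rewrite (row_mxEl s%:M) (row_mxEr s%:M) !mxE !mulr1n.
  move=> p; rewrite gE /gf qf_pfm0 /=.
  rewrite (bigD1 set0) //= big_set0 big1 => [|I]; last by rewrite (set_eq I) eqxx.
  by rewrite addr0; ring.
have [g [gB gq]] := IHm (fun i => b (widen_ord (leqnSn m) i))
  (fun i => bE (widen_ord (leqnSn m) i)).
have [h [gK hK]] := linear_inv gB.
pose p0 (p : {ffun {set 'I_m.+1} -> plane F}) : {ffun {set 'I_m} -> plane F} :=
  [ffun I : {set 'I_m} => p (slot_lift I)].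
pose p1 (p : {ffun {set 'I_m.+1} -> plane F}) : {ffun {set 'I_m} -> plane F} :=
  [ffun I : {set 'I_m} => p (ord_max |: slot_lift I)].
have [|G GE] := @linear_exists F _ 'rV[F]_(pfdim m.+2) (fun p => row_mx (g (p0 p)) (g (p1 p))).
  move=> c u v; rewrite scale_row_mx add_row_mx -!linearP; congr (row_mx (g _) (g _));
  by apply/ffunP=> I; rewrite !ffunE.
exists G; split.
  exists (fun x : 'rV[F]_(pfdim m.+1 + pfdim m.+1) => [ffun J : {set 'I_m.+1} =>
      if ord_max \in J then h (rsubmx x) (slot_drop J)
      else h (lsubmx x) (slot_drop J)]) => [p|x].
    apply/ffunP=> J; rewrite ffunE GE row_mxKr row_mxKl !gK !ffunE.
    by rewrite -{4}(slot_dropK J); case: ifP.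
  rewrite GE; have [u [v ->]] := row_split x.
  congr row_mx; rewrite -[RHS]hK; congr (g _); apply/ffunP=> I; rewrite !ffunE.
    by rewrite ord_max_slot_lift slot_liftK row_mxKl.
  by rewrite !inE eqxx slot_lift_maxK row_mxKr.
move=> p; rewrite GE qf_pfmS !gq /= sum_slots mulr_sumr; congr (_ + _); apply: eq_bigr => I _.
  by rewrite prod_slot_lift ffunE.
by rewrite prod_slot_max ffunE mulrA -(bE ord_max).
Qed.

(* P consists of T and of a totally isotropic complement dual to T. *)
Lemma half_isotropic_basis (k : fieldType) (ch2 : 2%N \in [pchar k]) h (A : 'M[k]_(h + h))
    (T : 'M_(h, h + h)) :
  (forall x, (forall y, bf A x y = 0) -> x = 0) -> row_free T ->
  (forall v, qf A (v *m T) = 0) ->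
  exists2 P, P \in unitmx & forall x y, qf A (row_mx x y *m P) = (x *m y^T) 0 0.
Proof.
move=> ndA /row_freeP[D TD] qT; set S := A + A^T.
have Su : S \in unitmx.
  rewrite -row_free_unit -kermx_eq0; apply/eqP/row_matrixP=> i; rewrite row0.
  by apply: ndA => y; rewrite /bf -row_mul mulmx_ker row0 mul0mx mxE.
have bT u v : bf A (u *m T) (v *m T) = 0.
  by have := qT (u + v); rewrite mulmxDl qfD !qT !add0r.
(* The rows of [U0] are dual to those of [T] for the polar form. *)
pose U0 := (invmx S *m D)^T.
have bTU0 u v : bf A (u *m T) (v *m U0) = (u *m v^T) 0 0.
  rewrite /bf -/S trmx_mul trmxK -!mulmxA (mulmxA S) mulmxV // mul1mx (mulmxA T) TD.
  by rewrite mul1mx.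
(* The added element of the span of [T] pairs with [v *m U0] to [qf A (v *m U0)], and so cancels
   that value in characteristic 2. *)
pose U := U0 + U0 *m A *m U0^T *m T.
have UE v : v *m U = v *m U0 + (v *m (U0 *m A *m U0^T)) *m T.
  by rewrite mulmxDr !mulmxA.
have qU v : qf A (v *m U) = 0.
  rewrite UE qfD qT addr0 bfC bTU0 [qf A _]qf_mul -/(qf (U0 *m A *m U0^T) v).
  exact: addrr_pchar2.
have bTU u v : bf A (u *m T) (v *m U) = (u *m v^T) 0 0 by rewrite UE bfDr bTU0 bT addr0.
have qTU x y : qf A (row_mx x y *m col_mx T U) = (x *m y^T) 0 0.
  by rewrite mul_row_col qfD qT qU bTU !add0r.
exists (col_mx T U) => //.
rewrite -row_free_unit -kermx_eq0; apply/eqP/row_matrixP=> i; rewrite row0.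
have : row i (kermx (col_mx T U)) *m col_mx T U = 0 by rewrite -row_mul mulmx_ker row0.
rewrite -(hsubmxK (row i _)); move: (lsubmx _) (rsubmx _) => x y xy0.
have z0 u v : bf A (x *m T + y *m U) (u *m T + v *m U) = 0.
  by rewrite -mul_row_col xy0 bf0l.
have bUU u v : bf A (u *m U) (v *m U) = 0.
  by have := qU (u + v); rewrite mulmxDl qfD !qU !add0r.
have mul_delta (w : 'rV[k]_h) j : (w *m (delta_mx 0 j : 'rV_h)^T) 0 0 = w 0 j.
  by rewrite trmx_delta -colE !mxE.
rewrite -[RHS]row_mx0; congr row_mx; apply/rowP=> j; rewrite [RHS]mxE -mul_delta.
  by have := z0 0 (delta_mx 0 j); rewrite mul0mx add0r bfDl bUU addr0 bTU.
have := z0 (delta_mx 0 j) 0; rewrite mul0mx addr0 bfDl bT add0r bfC bTU.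
by rewrite -[_ *m y^T]mx11_tr trmx_mul trmxK.
Qed.

Lemma pfm_hyperbolic (k : fieldType) (ch2 : 2%N \in [pchar k]) (V : vectType k)
    (q : quadform V) m (b : nat -> k) a z :
  (forall i, b i != 0) -> presents q (pfm m b a) -> z != 0 -> qf (pfm m b a) z = 0 ->
  hyperbolic q.
Proof.
move=> b0 [g [gB gq]] z0 qz; have [T Tf qT] := pfm_isotropic_half b0 z0 qz.
have nd x : (forall y, bf (pfm m b a) x y = 0) -> x = 0 by exact: pfm_nondeg.
have [P Pu qP] := half_isotropic_basis ch2 nd Tf qT; exists (pfdim m).
pose r (v : 'rV[k]_(pfdim m + pfdim m)) : {ffun 'I_(pfdim m) -> plane k} :=
  [ffun i => (lsubmx (v *m invmx P) 0 i, rsubmx (v *m invmx P) 0 i)].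
have [|R RE] := @linear_exists k _ _ r.
  move=> c u v; apply/ffunP=> i; rewrite !ffunE mulmxDl -scalemxAl.
  by congr (_, _); rewrite !mxE.
exists (R \o g); split.
  apply: bij_comp => //.
  exists (fun p : {ffun 'I_(pfdim m) -> plane k} =>
      row_mx (\row_i ((p i).1 : k)) (\row_i ((p i).2 : k)) *m P) => [v|p].
    rewrite RE; have -> : row_mx (\row_i (r v i).1) (\row_i (r v i).2) = v *m invmx P.
      rewrite -[RHS]hsubmxK; congr row_mx; apply/rowP=> i; by rewrite mxE ffunE.
    by rewrite mulmxKV.
  rewrite RE; apply/ffunP=> i; rewrite ffunE mulmxK // row_mxKl row_mxKr !mxE.
  by case: (p i).
move=> v; rewrite -gq /= RE -[in RHS](mulmxKV Pu (g v)) -[g v *m _ in RHS]hsubmxK qP mxE.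
by apply: eq_bigr => i _; rewrite ffunE /= !mxE !mul0r add0r addr0.
Qed.

(** * Splitting over quadratic extensions *)

Lemma pf1_tr (R : comNzRingType) m : (pf1 R m *m (pf1 R m)^T) 0 0 = 1.
Proof.
elim: m => [|m IHm] /=; rewrite tr_row_mx mul_row_col trmx0 mulmx0 addr0 //.
by rewrite mul1mx !mxE.
Qed.

(** For [t] outside [E] write t^2 = x + y t. If y = 0, take e = 0; otherwise t / y is an
    Artin-Schreier generator, with e = 1. A root r in [E] would give (s + r)(s + r + e) = 0 for the
    generator s and put it in [E]. *)
Lemma quadratic_extension_gen (E : fieldType) (ch2 : 2%N \in [pchar E]) (K : fieldExtType E) :
  \dim {:K} = 2%N -> exists (t : K) (x : E) (e : bool),
    [/\ t ^+ 2 + e%:R * t = in_alg K x, forall y, t <> in_alg K y &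
        forall y, y ^+ 2 + e%:R * y <> x].
Proof.
move=> dimK; have ch2K := rmorph_pchar (in_alg K) ch2.
have [t tN] : exists t : K, t \notin 1%VS.
  apply: contrapT => all1; have : (fullv <= (1 : {vspace K}))%VS.
    by apply/subvP => t _; apply: contrapT => /negP tN; apply: all1; exists t.
  by move=> /dimvS; rewrite dimK dimv1.
have tN1 y : t <> in_alg K y by move=> ty; move/negP: tN; apply; rewrite ty; apply/vlineP; exists y.
have spanE z : exists x y, z = in_alg K x + y *: t.
  have full : (fullv <= 1 + <[t]>)%VS.
    rewrite -(geq_leqif (dimv_leqif_sup (subvf _))) dimK dimv_disjoint_sum ?dimv1 ?dim_vline.
      by case: eqP tN => // ->; rewrite mem0v.
    apply/eqP; rewrite -subv0; apply/subvP=> w; rewrite memv_cap memv0.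
    move=> /andP[w1 /vlineP[c wE]]; rewrite wE in w1 *; apply: contraR tN => ct0.
    have c0 : c != 0 by apply: contra ct0 => /eqP ->; rewrite scale0r.
    by rewrite -(scale1r t) -(mulVf c0) -scalerA memvZ.
  have /memv_addP[u /vlineP[x ->] [w /vlineP[y ->] ->]] : z \in (1 + <[t]>)%VS.
    by apply: (subvP full); exact: memvf.
  by exists x, y.
have [x [y t2]] := spanE (t ^+ 2).
have addK2 (u w : K) : u + w + w = u by rewrite -addrA addrr_pchar2 // addr0.
have noroot (s : K) (x' : E) (e : bool) : s ^+ 2 + e%:R * s = in_alg K x' ->
    (forall y, s <> in_alg K y) -> forall r, r ^+ 2 + e%:R * r <> x'.
  move=> sE sN r rE; have : (s + in_alg K r) * (s + in_alg K r + e%:R) = 0.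
    transitivity ((s ^+ 2 + e%:R * s) + in_alg K (r ^+ 2 + e%:R * r) + (s * in_alg K r) *+ 2).
      by rewrite rmorphD rmorphXn rmorphM rmorph_nat /=; ring.
    by rewrite sE rE mulrn_pchar // addr0 addrr_pchar2.
  move=> /eqP; rewrite mulf_eq0 -addrA => /orP[]; rewrite addr_eq0 oppr_pchar2 // => /eqP sr.
    exact: sN sr.
  by apply: (sN (r + e%:R)); rewrite sr rmorphD rmorph_nat.
have [y0|y0] := eqVneq y 0.
  have tE : t ^+ 2 + false%:R * t = in_alg K x by rewrite t2 y0 scale0r addr0 mul0r addr0.
  by exists t, x, false; split=> //; exact: noroot tE tN1.
pose s := y^-1 *: t.
have sN z : s <> in_alg K z.
  move=> sz; apply: (tN1 (y * z)); move: sz; rewrite /s /= => sz.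
  by rewrite -scalerA -sz scalerA divff // scale1r.
have sE : s ^+ 2 + true%:R * s = in_alg K (x / y ^+ 2).
  rewrite /s exprZn t2 scalerDr mul1r (scalerA _ y t).
  have -> : y^-1 ^+ 2 * y = y^-1 by field.
  by rewrite -addrA addrr_pchar2 // addr0 /= scalerA mulrC exprVn.
by exists s, (x / y ^+ 2), true; split=> //; exact: noroot sE sN.
Qed.

Lemma resolved_isotropic (k E : fieldType) (ch2 : 2%N \in [pchar E]) (f : {rmorphism k -> E})
    n b a (K : fieldExtType E) t x (e : bool) :
  t ^+ 2 + e%:R * t = in_alg K x -> (forall y, t <> in_alg K y) ->
  attains f (pfm n b a) x e ->
  exists2 z, z != 0 & qf (map_mx (in_alg K) (map_mx f (pfm n b a))) z = 0.
Proof.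
move=> tx tN [y [qy by_]]; have ch2K := rmorph_pchar (in_alg K) ch2.
exists (t *: pf1 K n + map_mx (in_alg K) y).
  (* If the vector were zero, the coordinate of [y] along [pf1] would place [t] in [E]. *)
  apply/eqP=> z0; apply: (tN (- (y *m (pf1 E n)^T) 0 0)).
  have yE : map_mx (in_alg K) y = - (t *: pf1 K n).
    by apply/eqP; rewrite -addr_eq0 addrC z0.
  rewrite rmorphN -map_mxE map_mxM -map_trmx map_pf1 yE mulNmx -scalemxAl.
  by rewrite [(- _ : 'M__) 0 0]mxE [(_ *: _ : 'M__) 0 0]mxE pf1_tr mulr1 opprK.
rewrite qfD qfZ bfZl -(map_pf1 (in_alg K)) !qf_map bf_map qy by_.
rewrite map_pfm qf_pf1 rmorph1 mulr1 rmorph_nat addrAC [t * _]mulrC tx.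
exact: addrr_pchar2.
Qed.

Lemma pfister_presentation (F : fieldType) n (V : vectType F) (q : quadform V) :
  is_pfister n q -> exists b a, (forall i, b i != 0) /\ presents q (pfm n.-1 b a).
Proof.
move=> [_ [b [a [b0 [g [gB gq]]]]]].
(* The default 1 keeps the slots nonzero at every index. *)
pose b' i := if insub i is Some j then b j else 1.
have [h [hB hq]] : presents (pfister b a) (pfm n.-1 b' a).
  by apply: presents_pfister => i; rewrite /b' valK.
exists b', a; split=> [i|].
  by rewrite /b'; case: insub => [j|]; [exact: b0 | exact: oner_neq0].
exists (h \o g); split; first exact: bij_comp.
by move=> v; rewrite /= hq gq.
Qed.

Theorem theorem5p7 (F : fieldType) (charF2 : 2%N \in [pchar F])
    (n : nat) (n_gt1 : (1 < n)%N) (V V' : vectType F)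
    (pi : quadform V) (pi' : quadform V')
    (pi_pfister : is_pfister n pi) (pi'_pfister : is_pfister n pi')
    (pi_anisotropic : anisotropic pi) (pi'_anisotropic : anisotropic pi')
    (pi_pi'_not_isometric : ~ isometric pi pi') :
  exists (E : fieldType) (f : {rmorphism F -> E}),
    [/\ anisotropic (scalar_ext f pi), anisotropic (scalar_ext f pi'),
        totally_separably_linked (scalar_ext f pi) (scalar_ext f pi'),
        totally_inseparably_linked (scalar_ext f pi) (scalar_ext f pi')
      & ~ isometric (scalar_ext f pi) (scalar_ext f pi')].
Proof.
have [b [a [b0 pA]]] := pfister_presentation pi_pfister.
have [c [d [c0 pA']]] := pfister_presentation pi'_pfister.
have n0 : (0 < n.-1)%N by rewrite -subn1 subn_gt0.
set A := pfm n.-1 b a in pA; set A' := pfm n.-1 c d in pA'.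
have anA : aniso A := aniso_presents pA pi_anisotropic.
have anA' : aniso A' := aniso_presents pA' pi'_anisotropic.
have [|E [f [[gA gA' gAA'] res]]] :=
  @good_closure F charF2 n.-1 b a c d n0 b0 c0 F idfun.
  split; rewrite !map_mx_id // => isoAA'; apply: pi_pi'_not_isometric.
  exact: iso_isometric pA pA' anA isoAA'.
have chE := rmorph_pchar f charF2.
have pAE := presents_scalar_ext f pA; have pAE' := presents_scalar_ext f pA'.
(* Every quadratic extension of [E], separable or not, splits the form: the equation of its
   generator has no root in [E], so resolution must supply the vector. *)
have hyp (W : vectType E) (q : quadform W) (b1 : nat -> F) a1 (K : fieldExtType E) :
    (forall i, b1 i != 0) -> presents q (map_mx f (pfm n.-1 b1 a1)) -> \dim {:K} = 2%N ->
    (forall (x : E) (e : bool),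
       (exists t, t ^+ 2 + e%:R * t = x) \/ attains f (pfm n.-1 b1 a1) x e) ->
    hyperbolic (scalar_ext (in_alg K) q).
  move=> b10 pq dimK res1; have [t [x [e [tx tN noroot]]]] := quadratic_extension_gen chE dimK.
  have [[r rx]|att] := res1 x e; first by case: (noroot r).
  have [z z0 qz] := resolved_isotropic chE tx tN att.
  have := presents_scalar_ext (in_alg K) pq; rewrite !map_pfm in qz * => pK.
  apply: (pfm_hyperbolic (rmorph_pchar (in_alg K) chE) _ pK z0 qz) => i.
  by change (in_alg K (f (b1 i)) != 0); rewrite !fmorph_eq0.
have hypA K dimK := hyp _ _ _ _ K b0 pAE dimK
  (fun x e => match res x e with or_introl r => or_introl r | or_intror r => or_intror r.1 end).
have hypA' K dimK := hyp _ _ _ _ K c0 pAE' dimK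
  (fun x e => match res x e with or_introl r => or_introl r | or_intror r => or_intror r.2 end).
exists E, f; split.
- exact: presents_aniso pAE gA.
- exact: presents_aniso pAE' gA'.
- by split=> K dimK _ _; [apply: hypA' | apply: hypA].
- by split=> K dimK _ _; [apply: hypA' | apply: hypA].
by move=> /(isometric_iso pAE pAE').
Qed.
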